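(* Let $0<q<1$, $0<a<q^{-2}$, and let $\mu(x;a)=q^{-x}+aq^{x+1}$. For all nonnegative integers $n,n'$ the dual discrete $q$-ultraspherical polynomials satisfy the two orthogonality relations $$\sum_{k=0}^\infty\frac{(1-aq^{4k+1})(aq;q)_{2k}}{(1-aq)(q;q)_{2k}}\,q^{k(2k-1)}D_n^{(a)}(\mu(2k;a)|q)\,D_{n'}^{(a)}(\mu(2k;a)|q)=\frac{(aq^3;q^2)_\infty}{(q;q^2)_\infty}\,\frac{(q^2;q^2)_n\,q^{-n}}{(aq^2;q^2)_n}\,\delta_{nn'},$$ $$\sum_{k=0}^\infty\frac{(1-aq^{4k+3})(aq;q)_{2k+1}}{(1-aq)(q;q)_{2k+1}}\,q^{k(2k+1)}D_n^{(a)}(\mu(2k+1;a)|q)\,D_{n'}^{(a)}(\mu(2k+1;a)|q)=\frac{(aq^3;q^2)_\infty}{(q;q^2)_\infty}\,\frac{(q^2;q^2)_n\,q^{-n}}{(aq^2;q^2)_n}\,\delta_{nn'} .$$ Moreover, both corresponding orthogonality measures (supported on $\{\mu(2k;a)\}_{k\ge0}$ and on $\{\mu(2k+1;a)\}_{k\ge0}$, respectively) are extremal.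
   Context: Notation: $(x;p)_k=\prod_{j=0}^{k-1}(1-xp^j)$, $(x;p)_\infty=\prod_{j\ge0}(1-xp^j)$, and ${}_3\phi_2(\alpha_1,\alpha_2,\alpha_3;\beta_1,\beta_2;q,z)=\sum_{k\ge0}\frac{(\alpha_1;q)_k(\alpha_2;q)_k(\alpha_3;q)_k}{(\beta_1;q)_k(\beta_2;q)_k(q;q)_k}z^k$. Dual discrete $q$-ultraspherical polynomials: $D_n^{(a)}(\mu(x;a)|q)={}_3\phi_2(q^{-x},aq^{x+1},q^{-n};\,\sqrt a\,q,-\sqrt a\,q;\,q,-q^{n+1})$, a polynomial of degree $n$ in $\mu(x;a)=q^{-x}+aq^{x+1}$ because $(q^{-x};q)_k(aq^{x+1};q)_k=\prod_{j=0}^{k-1}(1+aq^{2j+1}-q^j\mu(x;a))$. The quotients $(1-aq^{4k+1})(aq;q)_{2k}/(1-aq)$ and $(aq;q)_{2k+1}/(1-aq)$ are understood with the common factor $1-aq$ cancelled. An orthogonality measure $\mu$ for a family of polynomials is called extremal if the family is complete in $L^2(\mu)$. *)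

(* Defs.v *)
From HB Require Import structures.
From mathcomp Require Import all_boot all_order all_algebra.
From mathcomp Require Import all_classical all_reals all_analysis.
From mathcomp Require Import ring.
Set Implicit Arguments.
Unset Strict Implicit.
Unset Printing Implicit Defensive.
Import Order.TTheory GRing.Theory Num.Theory.
Import numFieldNormedType.Exports.
Local Open Scope classical_set_scope.
Local Open Scope ring_scope.

Section BasicHypergeometric.
Context {R : realType}.
Implicit Types (x p q z a : R) (k n : nat).

Definition qpoch x p k : R := \prod_(0 <= j < k) (1 - x * p ^+ j).

Definition qpoch_inf x p : R := limn (qpoch x p).

Definition phi32_term (a1 a2 a3 b1 b2 q z : R) k : R :=
  (qpoch a1 q k * qpoch a2 q k * qpoch a3 q k) /
  (qpoch b1 q k * qpoch b2 q k * qpoch q q k) * z ^+ k.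

Definition phi32 (a1 a2 a3 b1 b2 q z : R) : R :=
  limn (series (phi32_term a1 a2 a3 b1 b2 q z)).

Definition qlattice q a x : R := q `^ (- x) + a * q `^ (x + 1).

(* The polynomial D_n in the variable mu(x; a) is determined by its values
   on the lattice; existence and uniqueness are [dual_qultraE] and
   [dual_qultra_unique]. *)
Definition dual_qultra q a n : {poly R} :=
  xget 0 [set P : {poly R} | forall x : R,
    P.[qlattice q a x] =
    phi32 (q `^ (- x)) (a * q `^ (x + 1)) (q ^- n)
          (Num.sqrt a * q) (- Num.sqrt a * q) q (- q ^+ n.+1)].

(* (1 - a q^(4k+1)) (aq; q)_(2k) / (1 - aq) with the factor 1 - aq cancelled:
   for k = 0 it cancels against 1 - a q^(4k+1), for k > 0 against the first
   factor of (aq; q)_(2k).  See [even_numE]. *)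
Definition even_num q a k : R :=
  if k is k'.+1 then (1 - a * q ^+ (4 * k + 1)) * qpoch (a * q ^+ 2) q (2 * k').+1
  else 1.

(* (1 - a q^(4k+3)) (aq; q)_(2k+1) / (1 - aq), likewise; see [odd_numE]. *)
Definition odd_num q a k : R :=
  (1 - a * q ^+ (4 * k + 3)) * qpoch (a * q ^+ 2) q (2 * k).

(* For k = 0 the truncated 2 * k - 1 is harmless, the exponent being 0. *)
Definition even_weight q a k : R :=
  even_num q a k / qpoch q q (2 * k) * q ^+ (k * (2 * k - 1)).

Definition odd_weight q a k : R :=
  odd_num q a k / qpoch q q (2 * k + 1) * q ^+ (k * (2 * k + 1)).

End BasicHypergeometric.

Section OrthogonalityMeasures.
Context {R : realType}.

(* The measure putting mass `|w k| at x k.  The absolute value only supplies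
   the sign condition required by [mscale]: the weights used here are
   positive, by [even_weight_gt0] and [odd_weight_gt0]. *)
Definition point_masses (w x : nat -> R) :
    {measure set (measurableTypeR R) -> \bar R} :=
  mseries (fun k => mscale `|w k|%:nng (dirac (x k : measurableTypeR R))) 0.

Definition orthogonality_measure
    (m : {measure set (measurableTypeR R) -> \bar R}) (P : nat -> {poly R}) :=
  [/\ forall n, (fun x => (P n).[x]) \in Lfun m 2%:E,
      forall n n', n != n' ->
        (\int[m]_x ((P n).[x] * (P n').[x])%:E = 0)%E
    & forall n, (0 < \int[m]_x ((P n).[x] ^+ 2)%:E)%E].

Definition complete_in_L2
    (m : {measure set (measurableTypeR R) -> \bar R}) (P : nat -> {poly R}) :=
  forall f : measurableTypeR R -> R, f \in Lfun m 2%:E ->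
  forall e : R, 0 < e -> exists (N : nat) (c : nat -> R),
    ('N[m]_2%:E[EFin \o (fun x => (f x - \sum_(0 <= i < N) c i * (P i).[x])%R)]
       < e%:E)%E.

Definition extremal
    (m : {measure set (measurableTypeR R) -> \bar R}) (P : nat -> {poly R}) :=
  orthogonality_measure m P /\ complete_in_L2 m P.

End OrthogonalityMeasures.

Section Facts.
Context {R : realType}.
Implicit Types (x p q z a : R) (k n : nat).

Lemma qpochS x p k : qpoch x p k.+1 = qpoch x p k * (1 - x * p ^+ k).
Proof. by rewrite /qpoch big_nat_recr. Qed.

Lemma qpochSl x p k : qpoch x p k.+1 = (1 - x) * qpoch (x * p) p k.
Proof.
rewrite /qpoch big_nat_recl// expr0 mulr1; congr (_ * _).
by apply: eq_bigr => i _; rewrite exprS mulrA.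
Qed.

Lemma qpoch_gt0 x p k : 0 < p -> p < 1 -> x < 1 -> 0 < qpoch x p k.
Proof.
move=> p0 p1 x1; rewrite /qpoch; apply: prodr_gt0 => i _.
rewrite subr_gt0; have [x0|x0] := leP x 0.
  by rewrite (le_lt_trans _ ltr01)// mulr_le0_ge0// exprn_ge0// ltW.
by apply: le_lt_trans x1; rewrite ler_piMr ?(ltW x0)// exprn_ile1// ltW.
Qed.

Lemma qpoch_eq0 q n k : q != 0 -> (n < k)%N -> qpoch (q ^- n) q k = 0.
Proof.
move=> q0 nk; rewrite /qpoch big_mkord (bigD1 (Ordinal nk))//=.
by rewrite mulVf ?expf_neq0// subrr mul0r.
Qed.

Lemma phi32_terminating (a1 a2 b1 b2 q z : R) n : q != 0 ->
  phi32 a1 a2 (q ^- n) b1 b2 q z =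
  \sum_(0 <= k < n.+1) phi32_term a1 a2 (q ^- n) b1 b2 q z k.
Proof.
move=> q0; apply: cvg_lim => //; apply: cvg_near_cst; near=> m.
have nm : (n.+1 <= m)%N by near: m; exact: nbhs_infty_ge.
rewrite /series/= (big_cat_nat _ nm)//= [X in _ + X](_ : _ = 0) ?addr0// big_nat_cond big1//.
move=> i /andP[/andP[ni _] _].
by rewrite /phi32_term qpoch_eq0// mulr0 !mul0r.
Unshelve. all: by end_near. Qed.

Lemma qpoch_lattice q a x k : 0 < q ->
  qpoch (q `^ (- x)) q k * qpoch (a * q `^ (x + 1)) q k =
  \prod_(0 <= j < k) (1 + a * q ^+ (2 * j + 1) - q ^+ j * qlattice q a x).
Proof.
move=> q0; rewrite /qpoch -big_split/=; apply: eq_bigr => j _.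
have xK : q `^ (- x) * q `^ (x + 1) = q.
  rewrite -powRD; last by rewrite (gt_eqF q0) implybT.
  by rewrite addrA addNr add0r powRr1// ltW.
have -> : q ^+ (2 * j + 1) = q `^ (- x) * q `^ (x + 1) * (q ^+ j * q ^+ j).
  by rewrite xK addn1 exprS mul2n -addnn exprD.
by rewrite /qlattice; ring.
Qed.

Lemma dual_qultraE q a n x : 0 < q ->
  (dual_qultra q a n).[qlattice q a x] =
  phi32 (q `^ (- x)) (a * q `^ (x + 1)) (q ^- n)
        (Num.sqrt a * q) (- Num.sqrt a * q) q (- q ^+ n.+1).
Proof.
move=> q0; move: x; rewrite /dual_qultra; case: xgetP => [P _ //|none].
pose P : {poly R} := \sum_(0 <= k < n.+1)
  (qpoch (q ^- n) q k / (qpoch (Num.sqrt a * q) q k *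
     qpoch (- Num.sqrt a * q) q k * qpoch q q k) * (- q ^+ n.+1) ^+ k) *:
  \prod_(0 <= j < k) ((1 + a * q ^+ (2 * j + 1))%:P - q ^+ j *: 'X).
exfalso; apply: (none P) => x; rewrite phi32_terminating ?gt_eqF//.
rewrite horner_sum; apply: eq_bigr => k _.
rewrite hornerZ horner_prod /phi32_term qpoch_lattice//.
under eq_bigr do rewrite hornerD hornerN hornerZ hornerC hornerX.
by ring.
Qed.

Lemma qlattice_inj q a k n : 0 < q -> q < 1 -> 0 < a -> a < q ^- 2 ->
  qlattice q a k%:R = qlattice q a n%:R -> k = n.
Proof.
move=> q0 q1 a0 aq.
wlog kn : k n / (k <= n)%N.
  by move=> H; case/orP: (leq_total k n) => [/H//|/H + /esym] => /[apply].
have aq2 : a * q ^+ 2 < 1 by rewrite -ltr_pdivlMr ?exprn_gt0// div1r.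
rewrite /qlattice !natr1 !powR_mulrn ?(ltW q0)// !powRN !powR_mulrn ?(ltW q0)//.
move=> e; apply/eqP; rewrite eqn_leq kn/= leqNgt; apply/negP => lt_kn.
have [d nE] : exists d, n = (k + d.+1)%N.
  by exists (n - k.+1)%N; rewrite addnS -addSn subnKC.
have /eqP : (1 - q ^+ d.+1) * (1 - a * q ^+ (k + n).+1) = 0.
  have qk0 : q ^+ k != 0 by rewrite expf_neq0// gt_eqF.
  have qd0 : q ^+ d != 0 by rewrite expf_neq0// gt_eqF.
  have q0' : q != 0 by rewrite gt_eqF.
  transitivity (q ^+ n * ((q ^+ n)^-1 + a * q ^+ n.+1
                          - ((q ^+ k)^-1 + a * q ^+ k.+1))).
    by rewrite nE !exprS !exprD !exprS; field; rewrite qk0 qd0 q0'.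
  by rewrite e subrr mulr0.
rewrite mulf_eq0 !subr_eq0 => /orP[|] /eqP E.
  by have := exprn_ilt1 d.+1 (ltW q0) q1; rewrite -E ltxx.
suff : a * q ^+ (k + n).+1 < 1 by rewrite -E ltxx.
apply: le_lt_trans aq2; rewrite ler_pM2l//.
by apply: ler_wiXn2l; rewrite ?(ltW q0) ?(ltW q1)// nE !addnS.
Qed.

Lemma dual_qultra_unique q a n (P : {poly R}) :
  0 < q -> q < 1 -> 0 < a -> a < q ^- 2 ->
  (forall x, P.[qlattice q a x] =
     phi32 (q `^ (- x)) (a * q `^ (x + 1)) (q ^- n)
           (Num.sqrt a * q) (- Num.sqrt a * q) q (- q ^+ n.+1)) ->
  P = dual_qultra q a n.
Proof.
move=> q0 q1 a0 aq PE; apply/eqP; rewrite -subr_eq0; apply/negPn/negP => Pn0.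
pose s := [seq qlattice q a k%:R | k <- iota 0 (size (P - dual_qultra q a n))].
have /(max_poly_roots Pn0) : all (root (P - dual_qultra q a n)) s.
  apply/allP => y /mapP[k _ ->].
  by rewrite /root hornerD hornerN PE dual_qultraE// subrr.
rewrite map_inj_uniq ?iota_uniq ?size_map ?size_iota ?ltnn; last first.
  by move=> k k'; exact: qlattice_inj.
by move=> /(_ isT).
Qed.

Lemma even_numE q a k : 1 - a * q != 0 ->
  even_num q a k =
  (1 - a * q ^+ (4 * k + 1)) * qpoch (a * q) q (2 * k) / (1 - a * q).
Proof.
move=> aq; case: k => [|k].
  by rewrite /even_num !muln0 /qpoch big_nil mulr1 divff.
rewrite (mulnS 2) add2n qpochSl -(mulrA a) -expr2 /even_num.
by field.
Qed.

Lemma odd_numE q a k : 1 - a * q != 0 ->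
  odd_num q a k =
  (1 - a * q ^+ (4 * k + 3)) * qpoch (a * q) q (2 * k + 1) / (1 - a * q).
Proof.
by move=> aq; rewrite addn1 qpochSl -(mulrA a) -expr2 /odd_num; field.
Qed.

Lemma even_weight_gt0 q a k : 0 < q -> q < 1 -> 0 < a -> a < q ^- 2 ->
  0 < even_weight q a k.
Proof.
move=> q0 q1 a0 aq.
have aq2 : a * q ^+ 2 < 1 by rewrite -ltr_pdivlMr ?exprn_gt0// div1r.
rewrite /even_weight mulr_gt0 ?exprn_gt0// divr_gt0 ?qpoch_gt0//.
case: k => [//|k]; rewrite mulr_gt0 ?qpoch_gt0// subr_gt0.
apply: le_lt_trans aq2; rewrite ler_pM2l//.
by apply: ler_wiXn2l; rewrite ?(ltW q0) ?(ltW q1)// mulnS.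
Qed.

Lemma odd_weight_gt0 q a k : 0 < q -> q < 1 -> 0 < a -> a < q ^- 2 ->
  0 < odd_weight q a k.
Proof.
move=> q0 q1 a0 aq.
have aq2 : a * q ^+ 2 < 1 by rewrite -ltr_pdivlMr ?exprn_gt0// div1r.
rewrite /odd_weight mulr_gt0 ?exprn_gt0// divr_gt0 ?qpoch_gt0//.
rewrite mulr_gt0 ?qpoch_gt0// subr_gt0.
apply: le_lt_trans aq2; rewrite ler_pM2l//.
by apply: ler_wiXn2l; rewrite ?(ltW q0) ?(ltW q1)// addn3.
Qed.

End Facts.

(* Main.v *)
Require Import Defs.
From HB Require Import structures.
From mathcomp Require Import all_boot all_order all_algebra.
From mathcomp Require Import all_classical all_reals all_analysis.
From mathcomp Require Import measurable_realfun.
From mathcomp Require Import ring lra zify.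
Import Order.TTheory GRing.Theory Num.Theory.
Import numFieldNormedType.Exports.
Local Open Scope classical_set_scope.
Local Open Scope ring_scope.

Set Implicit Arguments.
Unset Strict Implicit.
Unset Printing Implicit Defensive.

(** Write p = q^2, mu(x) = q^(-x) + a q^(x+1) and
    h_n = S (p;p)_n q^(-n) / (a q^2;p)_n with S = (a q^3;p)_oo / (q;p)_oo.

    Row orthogonality.  Both weights are restrictions of one function w(x)
    ([dweight]) of the lattice index x.  Multiplying w by
    phi_j(x) = (q^(-x);q)_j (a q^(x+1);q)_j only shifts x by j, replaces a by
    a q^(2j), and multiplies by a constant ([dweight_shift]).  Hence every
    moment of phi_j reduces to the total mass, which is a limit of terminating
    very-well-poised sums evaluated by creative telescoping ([sum_vwp_term],
    [cvg_even_weight]); the alternating sum of w over all x telescopes and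
    tends to 0, so the even and the odd masses agree ([cvg_odd_weight]).
    Expanding D_n in the phi_j and using the q-binomial theorem shows that D_n,
    for n > 0, integrates to 0 ([has_moment_dual_qultra]).  The three-term
    recurrence of D_n in n ([dual_qultra_rec]) propagates this to all products
    D_m D_n ([has_moment_dual_qultraM]).

    Extremality.  At a fixed lattice index x, D_n is a polynomial in u = q^n,
    namely a discrete q-ultraspherical polynomial of degree x; its recurrence
    in x ([dual_val_rec]) shows that it has the parity of x
    ([dual_val_parity]).  So for indices x, y of the same parity the boundary
    term of the Christoffel-Darboux formula tends to 0, and the columns
    (D_n(mu(x)))_n are pairwise orthogonal in l^2(1/h)
    ([dual_qultra_column_orthogonal]).  A matrix with orthogonal rows and
    orthogonal columns is unitary after normalization: the squared norm of
    each column is the inverse of the weight ([cvg_ckernel_diag]).  This says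
    that indicators of lattice points are limits of combinations of the D_n,
    hence that the D_n are complete ([rows_dense],
    [extremal_point_masses]). *)

(** * q-Pochhammer symbols *)

Section QPochhammer.
Context {R : realType}.
Implicit Types (x p q a : R) (k n m : nat).

Lemma qpoch0 x p : qpoch x p 0 = 1.
Proof. by rewrite /qpoch big_nil. Qed.

Lemma qpochD x p m n : qpoch x p (m + n) = qpoch x p m * qpoch (x * p ^+ m) p n.
Proof.
elim: n => [|n IH]; first by rewrite addn0 qpoch0 mulr1.
by rewrite addnS !qpochS IH exprD; ring.
Qed.

Lemma qpoch_double x p n :
  qpoch x p (2 * n) = qpoch x (p ^+ 2) n * qpoch (x * p) (p ^+ 2) n.
Proof.
elim: n => [|n IH]; first by rewrite muln0 !qpoch0 mulr1.
by rewrite mulnS add2n !qpochS IH -!exprM [p ^+ (2 * n).+1]exprS; ring.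
Qed.

Lemma qpoch_neq0 x p k : 0 < p -> p < 1 -> x < 1 -> qpoch x p k != 0.
Proof. by move=> p0 p1 x1; rewrite gt_eqF// qpoch_gt0. Qed.

Lemma qpoch_le1 x p k : 0 < p -> p < 1 -> 0 <= x -> x < 1 -> qpoch x p k <= 1.
Proof.
move=> p0 p1 x0 x1; elim: k => [|k IH]; first by rewrite qpoch0.
rewrite qpochS mulr_ile1 ?IH ?(ltW (qpoch_gt0 _ _ _ _))//.
  rewrite subr_ge0 (le_trans _ (ltW x1))// ler_piMr// exprn_ile1// ltW//.
by rewrite lerBlDr lerDl mulr_ge0// exprn_ge0// ltW.
Qed.

Lemma qpoch_nonincreasing x p : 0 < p -> p < 1 -> 0 <= x -> x < 1 ->
  {homo qpoch x p : m n / (m <= n)%N >-> n <= m}.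
Proof.
move=> p0 p1 x0 x1 m n mn; rewrite -(subnKC mn) qpochD ler_piMr//.
  by rewrite ltW// qpoch_gt0.
have xp : x * p ^+ m <= x by rewrite ler_piMr// exprn_ile1// ltW.
apply: qpoch_le1 => //; last exact: le_lt_trans x1.
by rewrite mulr_ge0// exprn_ge0// ltW.
Qed.

(** The Weierstrass product inequality, with a geometric bound for the sum. *)
Lemma qpoch_ge x p k : 0 < p -> p < 1 -> 0 <= x -> x < 1 ->
  1 - x / (1 - p) <= qpoch x p k.
Proof.
move=> p0 p1 x0 x1.
have p1' : 1 - p != 0 by rewrite gt_eqF// subr_gt0.
have pk m : 0 <= p ^+ m by rewrite exprn_ge0// ltW.
suff H : 1 - x * (1 - p ^+ k) / (1 - p) <= qpoch x p k.
  apply: le_trans H; rewrite lerD2l lerN2.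
  apply: ler_wpM2r; first by rewrite invr_ge0 subr_ge0 ltW.
  by rewrite ler_piMr// lerBlDr lerDl.
elim: k => [|k IH]; first by rewrite expr0 subrr mulr0 mul0r subr0 qpoch0.
have -> : 1 - x * (1 - p ^+ k.+1) / (1 - p) =
          1 - x * (1 - p ^+ k) / (1 - p) - x * p ^+ k.
  by rewrite exprS; field.
rewrite qpochS [leRHS]mulrBr mulr1 lerB// ler_piMl ?mulr_ge0//.
exact: qpoch_le1.
Qed.

Lemma cvg_qpoch x p : 0 < p -> p < 1 -> 0 <= x -> x < 1 ->
  qpoch x p @ \oo --> qpoch_inf x p.
Proof.
move=> p0 p1 x0 x1; apply: nonincreasing_is_cvgn.
  by apply/nonincreasing_seqP => n; apply: qpoch_nonincreasing.
by exists 0 => _ [n _ <-]; rewrite ltW// qpoch_gt0.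
Qed.

Lemma qpoch_inf_gt0 x p : 0 < p -> p < 1 -> 0 <= x -> x < 1 ->
  0 < qpoch_inf x p.
Proof.
move=> p0 p1 x0 x1.
(* Beyond some rank m the Weierstrass bound is at least 1/2. *)
have [m xm] : exists m, x * p ^+ m / (1 - p) <= 2^-1.
  have : (fun m => x * p ^+ m / (1 - p)) @ \oo --> x * 0 / (1 - p).
    apply: cvgMl; apply: cvgMr; apply: cvg_expr.
    by rewrite ger0_norm// ltW.
  rewrite mulr0 mul0r => /cvgrPdist_le /(_ 2^-1).
  rewrite invr_gt0 ltr0n => /(_ isT)[m _ /(_ m (leqnn m))] /=.
  rewrite sub0r normrN => h; exists m; apply: le_trans h; exact: ler_norm.
apply: (@lt_le_trans _ _ (qpoch x p m * 2^-1)).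
  by rewrite mulr_gt0 ?qpoch_gt0// invr_gt0 ltr0n.
apply: limr_ge; first by apply/cvg_ex; eexists; exact: cvg_qpoch.
exists m => // n /= mn; rewrite -(subnKC mn) qpochD.
rewrite ler_pM2l ?qpoch_gt0//.
have xpm : x * p ^+ m <= x by rewrite ler_piMr// exprn_ile1// ltW.
apply: le_trans (qpoch_ge _ _ _ _ _) => //.
- by rewrite lerBrDr -lerBrDl (le_trans xm)//; lra.
- by rewrite mulr_ge0// exprn_ge0// ltW.
- exact: le_lt_trans x1.
Qed.

Lemma qpoch_inf_le (x p : R) k : 0 < p -> p < 1 -> 0 <= x -> x < 1 ->
  qpoch_inf x p <= qpoch x p k.
Proof.
move=> p0 p1 x0 x1; apply: limr_le; first by apply/cvg_ex; eexists;
  exact: cvg_qpoch.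
by exists k => // n /= kn; exact: qpoch_nonincreasing.
Qed.

Lemma qpoch_infD (x p : R) k : 0 < p -> p < 1 -> 0 <= x -> x < 1 ->
  qpoch_inf x p = qpoch x p k * qpoch_inf (x * p ^+ k) p.
Proof.
move=> p0 p1 x0 x1; apply: cvg_lim => //.
rewrite -(cvg_shiftn k).
under eq_fun do rewrite addnC qpochD.
apply: cvgMr; apply: cvg_qpoch => //;
  first by rewrite mulr_ge0// exprn_ge0// ltW.
by apply: le_lt_trans x1; rewrite ler_piMr// exprn_ile1// ltW.
Qed.

End QPochhammer.

(** * The sum of the even weights *)

Section EvenWeightSum.
Context {R : realType}.
Context (q a : R) (q_gt0 : 0 < q) (q_lt1 : q < 1) (a_gt0 : 0 < a)
  (a_lt : a < q ^- 2).
Implicit Types (k m N : nat) (U : R).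

Let p := q ^+ 2.

Lemma aq2_lt1 : a * q ^+ 2 < 1.
Proof. by rewrite -ltr_pdivlMr ?exprn_gt0// div1r. Qed.

Lemma aqn_lt1 n : (2 <= n)%N -> a * q ^+ n < 1.
Proof.
move=> n2; apply: le_lt_trans aq2_lt1; rewrite ler_pM2l//.
by apply: ler_wiXn2l => //; rewrite ltW.
Qed.

Lemma q2_gt0 : 0 < q ^+ 2. Proof. exact: exprn_gt0. Qed.

Lemma q2_lt1 : q ^+ 2 < 1. Proof. by rewrite exprn_ilt1// ltW. Qed.

Lemma qn_lt1 n : (0 < n)%N -> q ^+ n < 1.
Proof. by move=> n0; rewrite exprn_ilt1 -?lt0n// ltW. Qed.

(** The summand of a very-well-poised series in base p.  For U = p^N the series
    terminates at k = N, and as U tends to 0 the summand tends to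
    [even_weight q a k]. *)
Definition vwp_term U k : R :=
  even_weight q a k * (qpoch U p^-1 k / qpoch (a * q ^+ 3 * U) p k).

(** Creative telescoping: the summands for U and for p U differ, up to the
    factors displayed, by a difference in k of the closed form on the right. *)
Lemma vwp_term_telescope U m : 0 <= U -> U <= 1 ->
  \sum_(0 <= k < m.+1)
     ((1 - q * U) * vwp_term (p * U) k - (1 - a * q ^+ 3 * U) * vwp_term U k) =
  - U * q * q ^+ (2 * m) * (qpoch (a * q ^+ 2) q (2 * m).+1 / qpoch q q (2 * m))
    * q ^+ (m * (2 * m - 1))
    * (qpoch U p^-1 m / qpoch (a * q ^+ 3 * U) p m)
    * (1 - a * q ^+ 3 * U) / (1 - a * q ^+ 3 * U * q ^+ (2 * m)).
Proof.
move=> U0 U1.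
have aU n : 1 - a * q ^+ 3 * U * q ^+ n != 0.
  rewrite gt_eqF// subr_gt0 (le_lt_trans _ (@aqn_lt1 3 isT))//.
  rewrite -[leRHS]mulr1 -mulrA ler_pM2l ?mulr_gt0 ?exprn_gt0//.
  by rewrite mulr_ile1// ?exprn_ge0 ?exprn_ile1// ltW.
have q0 : q != 0 by rewrite gt_eqF.
have p0 : p != 0 by rewrite expf_neq0.
elim: m => [|m IH].
  rewrite big_nat1 /vwp_term /even_weight
    /even_num !muln0 !expr0 !qpoch0 qpochS qpoch0.
  have aU0 := aU 0%N; rewrite expr0 mulr1 in aU0.
  by rewrite !mulr1; field.
rewrite big_nat_recr//= IH.
have aU0 : 1 - a * q ^+ 3 * U != 0 by have := aU 0%N; rewrite expr0 mulr1.
pose Q := qpoch U p^-1 m; pose P := qpoch (a * q ^+ 3 * U) p m.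
pose B := qpoch (a * q ^+ 2) q (2 * m).+1; pose C := qpoch q q (2 * m).
pose K := q ^+ (2 * m); pose E := q ^+ (m * (2 * m - 1)).
have P0 : P != 0.
  rewrite qpoch_neq0//; first exact: q2_gt0.
    exact: q2_lt1.
  by rewrite -subr_gt0 lt_neqAle eq_sym aU0 subr_ge0
    (le_trans _ (ltW (@aqn_lt1 3 isT)))// ler_piMr// mulr_ge0// ?exprn_ge0//
    ltW.
have C0 : C != 0 by rewrite qpoch_neq0.
have pm : p ^+ m = K by rewrite -exprM.
have K0 : K != 0 by rewrite expf_neq0.
have EN : q ^+ (m.+1 * (2 * m.+1 - 1)) = E * q * K * K.
  by rewrite /E /K -exprSr -!exprD; congr (_ ^+ _); clear; case: m => // j; nia.
have CN : qpoch q q (2 * m.+1) = C * (1 - q * K) * (1 - q ^+ 2 * K).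
  by rewrite (mulnS 2) add2n !qpochS -/C -/K [q ^+ _.+1]exprS mulrA.
have BN : qpoch (a * q ^+ 2) q (2 * m.+1).+1 =
    B * (1 - a * q ^+ 3 * K) * (1 - a * q ^+ 4 * K).
  rewrite (mulnS 2) add2n 2!qpochS -/B; congr (_ * (1 - _) * (1 - _)).
    by rewrite [q ^+ (2 * m).+1]exprS -/K; ring.
  by rewrite [q ^+ (2 * m).+2]exprS [q ^+ (2 * m).+1]exprS -/K; ring.
have ew : even_weight q a m.+1 =
  (1 - a * q ^+ 5 * K ^+ 2) * B / (C * (1 - q * K) * (1 - q ^+ 2 * K))
  * (E * q * K * K).
  rewrite /even_weight EN CN /even_num -/B.
  have -> : q ^+ (4 * m.+1 + 1) = q ^+ 5 * K ^+ 2.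
    by rewrite /K -exprM -exprD; congr (_ ^+ _); clear; lia.
  by rewrite (mulrA a).
have wz1 : (1 - a * q ^+ 3 * U) * vwp_term (p * U) m.+1 = even_weight q a m.+1 *
  ((1 - p * U) * Q / (P * (1 - a * q ^+ 3 * U * K)
    * (1 - a * q ^+ 3 * U * p * K)) * (1 - a * q ^+ 3 * U) ^+ 2).
  have e : qpoch (a * q ^+ 3 * U) p m.+2 =
    (1 - a * q ^+ 3 * U) * qpoch (a * q ^+ 3 * (p * U)) p m.+1.
    by rewrite qpochSl; congr (_ * qpoch _ _ _); ring.
  have e2 : qpoch (a * q ^+ 3 * U) p m.+2 =
    P * (1 - a * q ^+ 3 * U * K) * (1 - a * q ^+ 3 * U * p * K).
    by rewrite !qpochS [p ^+ m.+1]exprS pm -/P !mulrA.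
  rewrite -e2 e /vwp_term qpochSl [p * U * _]mulrAC divff// mul1r -/Q.
  have : qpoch (a * q ^+ 3 * U) p m.+2 != 0.
    rewrite e2 !mulf_neq0 ?aU//.
    by rewrite /K /p -mulrA -exprD aU.
  rewrite e mulf_eq0 negb_or => /andP[_ ?].
  by field; apply/andP; split.
have wz2 : vwp_term U m.+1 =
  even_weight q a m.+1 * (Q * (1 - U / K) / (P * (1 - a * q ^+ 3 * U * K))).
  by rewrite /vwp_term !qpochS exprVn pm.
have -> : (1 - q * U) * vwp_term (p * U) m.+1 =
  (1 - q * U) * even_weight q a m.+1 *
  ((1 - p * U) * Q / (P * (1 - a * q ^+ 3 * U * K)
    * (1 - a * q ^+ 3 * U * p * K)) * (1 - a * q ^+ 3 * U)).
  by apply: (mulfI aU0); rewrite mulrCA wz1; ring.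
rewrite wz2 ew EN CN BN -/B -/C (mulnS 2) exprD [qpoch U _ m.+1]qpochS
  [qpoch (a * q ^+ 3 * U) _ m.+1]qpochS pm -/K -/Q -/P -/E exprVn pm.
have qn n : 1 - q ^+ n.+1 != 0 by rewrite gt_eqF// subr_gt0 qn_lt1.
have := aU (2 * m)%N; have := aU (2 + 2 * m)%N; rewrite exprD -/K => h1 h2.
have h3 : 1 - q * K != 0 by rewrite /K -exprS qn.
have h4 : 1 - q ^+ 2 * K != 0 by rewrite /K -exprD qn.
rewrite /p; field.
by rewrite ?h3 ?h4 ?K0 ?P0 ?C0 ?h1 ?h2 ?q0 /=; repeat (apply/andP; split).
Qed.

Let q0 : q != 0. Proof. by rewrite gt_eqF. Qed.
Let p_gt0 : 0 < p. Proof. exact: q2_gt0. Qed.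
Let p_lt1 : p < 1. Proof. exact: q2_lt1. Qed.
Let p0 : p != 0. Proof. by rewrite gt_eqF. Qed.
Let aq3_ge0 : 0 <= a * q ^+ 3.
Proof. by rewrite ltW// mulr_gt0// exprn_gt0. Qed.
Let aq3_lt1 : a * q ^+ 3 < 1. Proof. exact: aqn_lt1. Qed.
Let aq3p_ge0 N : 0 <= a * q ^+ 3 * p ^+ N.
Proof. by rewrite mulr_ge0// exprn_ge0// ltW. Qed.
Let aq3p_lt1 N : a * q ^+ 3 * p ^+ N < 1.
Proof. by apply: le_lt_trans aq3_lt1; rewrite ler_piMr// exprn_ile1// ltW. Qed.

Lemma qpoch_pN_eq0 N : qpoch (p ^+ N) p^-1 N.+1 = 0.
Proof. by rewrite qpochS exprVn divff ?subrr ?mulr0// expf_neq0. Qed.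

Lemma vwp_term_pN_eq0 N : vwp_term (p ^+ N) N.+1 = 0.
Proof. by rewrite /vwp_term qpoch_pN_eq0 mul0r mulr0. Qed.

(** Each factor is of the form 1 - p^(N - i) with N - i >= M. *)
Lemma qpoch_pN_bounds M N k : (M + k <= N)%N ->
  (1 - p ^+ M) ^+ k <= qpoch (p ^+ N) p^-1 k <= 1.
Proof.
have pM1 m : p ^+ m <= 1 by rewrite exprn_ile1// ltW.
elim: k => [|k IH] MkN; first by rewrite expr0 qpoch0 lexx.
have [/IH/andP[h1 h2] kN] : (M + k <= N)%N /\ (k <= N)%N.
  by move: MkN; clear; lia.
have -> : qpoch (p ^+ N) p^-1 k.+1 = qpoch (p ^+ N) p^-1 k * (1 - p ^+ (N - k)).
  rewrite qpochS exprVn; congr (_ * (1 - _)).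
  by rewrite -{1}(subnK kN) exprD mulfK// expf_neq0.
have pN : 1 - p ^+ M <= 1 - p ^+ (N - k).
  by rewrite lerD2l lerN2 ler_wiXn2l// ?ltW//; move: MkN; clear; lia.
have M0 : 0 <= 1 - p ^+ M by rewrite subr_ge0.
apply/andP; split; first by rewrite exprSr ler_pM// exprn_ge0.
rewrite mulr_ile1 ?(le_trans _ h1) ?exprn_ge0 ?(le_trans M0)//.
by rewrite lerBlDr lerDl exprn_ge0// ltW.
Qed.

Lemma even_weight_ge0 k : 0 <= even_weight q a k.
Proof. by rewrite ltW// even_weight_gt0. Qed.

Lemma vwp_term_ge M N k : (M + k <= N)%N ->
  (1 - p ^+ M) ^+ k * even_weight q a k <= vwp_term (p ^+ N) k.
Proof.
move=> MkN; have /andP[h _] := qpoch_pN_bounds MkN.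
rewrite mulrC ler_wpM2l ?even_weight_ge0// (le_trans h)//.
have P0 : 0 < qpoch (a * q ^+ 3 * p ^+ N) p k by rewrite qpoch_gt0.
rewrite ler_pdivlMr// ler_piMr ?qpoch_le1// (le_trans _ h)// exprn_ge0//.
by rewrite subr_ge0 exprn_ile1// ltW.
Qed.

Lemma vwp_term_le N k : (k <= N)%N ->
  vwp_term (p ^+ N) k <= even_weight q a k / qpoch (a * q ^+ 3 * p ^+ N) p N.
Proof.
move=> kN; have /andP[_ h] := @qpoch_pN_bounds 0 N k kN.
rewrite ler_wpM2l ?even_weight_ge0//.
have P0 m : 0 < qpoch (a * q ^+ 3 * p ^+ N) p m by rewrite qpoch_gt0.
rewrite ler_pdivrMr// mulrC (le_trans h)// ler_pdivlMr// mul1r.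
exact: qpoch_nonincreasing.
Qed.

(** A terminating case of the very-well-poised 6phi5 summation in base p. *)
Lemma sum_vwp_term N :
  \sum_(0 <= k < N.+1) vwp_term (p ^+ N) k =
    qpoch (a * q ^+ 3) p N / qpoch q p N.
Proof.
elim: N => [|N IH].
  rewrite big_nat1 /vwp_term /even_weight /even_num !muln0 !qpoch0 expr0.
  by rewrite !(mulr1, invr1).
have pN1 : p ^+ N <= 1 by rewrite exprn_ile1// ltW.
have pN0 : 0 <= p ^+ N by rewrite exprn_ge0// ltW.
have := vwp_term_telescope N.+1 pN0 pN1.
rewrite qpoch_pN_eq0 mul0r mulr0 !mul0r sumrB -!mulr_sumr.
rewrite [X in _ - _ * X]big_nat_recr//= vwp_term_pN_eq0 addr0 IH.
have h1 : 1 - q * p ^+ N != 0.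
  by rewrite gt_eqF// subr_gt0 -exprM -exprS qn_lt1.
have h2 : qpoch q p N != 0 by rewrite qpoch_neq0.
move=> /eqP; rewrite subr_eq0 => /eqP e; apply: (mulfI h1).
rewrite exprS e !qpochS; field.
by rewrite h1 h2.
Qed.

Let S_oo := qpoch_inf (a * q ^+ 3) p / qpoch_inf q p.

Let cvg_sum_vwp_term :
  (fun N => qpoch (a * q ^+ 3) p N / qpoch q p N) @ \oo --> S_oo.
Proof.
apply: cvgM; first exact: cvg_qpoch.
apply: cvgV; first by rewrite gt_eqF// qpoch_inf_gt0// ltW.
by apply: cvg_qpoch => //; rewrite ltW.
Qed.

(** The terminating sum for N = M + K bounds the first K weights up to the
    factor (1 - p^M)^K, which tends to 1 with M. *)
Lemma even_weight_sum_le K : \sum_(0 <= k < K) even_weight q a k <= S_oo.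
Proof.
pose S := \sum_(0 <= k < K) even_weight q a k.
have lhs : (fun M => (1 - p ^+ M) ^+ K * S) @ \oo --> S.
  rewrite -[X in _ --> X]mul1r -{2}(expr1n _ K); apply: cvgMl.
  have h1 : (fun M => 1 - p ^+ M) @ \oo --> (1 : R).
    rewrite -[X in _ --> X]subr0.
    by apply: cvgB; [exact: cvg_cst|apply: cvg_expr; rewrite ger0_norm// ltW].
  elim: (K) => [|n IH]; first by under eq_fun do rewrite expr0; exact: cvg_cst.
  by rewrite exprS; under eq_fun do rewrite exprS; exact: cvgM h1 IH.
have rhs := cvg_sum_vwp_term; rewrite -(cvg_shiftn K) in rhs.
apply: (ler_cvg_to lhs rhs); near=> M.
rewrite /= -sum_vwp_term (@big_cat_nat _ _ _ K)//=;
  last by rewrite leqW// leq_addl.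
rewrite -[leLHS]addr0 lerD//.
  rewrite mulr_sumr; apply: ler_sum_nat => k /andP[_ kK].
  apply: le_trans (@vwp_term_ge M _ _ _); last by rewrite leq_add2l ltnW.
  rewrite ler_wpM2r ?even_weight_ge0// ler_wiXn2l ?(ltnW kK)//.
    by rewrite subr_ge0 exprn_ile1// ltW.
  by rewrite lerBlDr lerDl exprn_ge0// ltW.
rewrite big_nat_cond sumr_ge0// => k /andP[/andP[_ kM] _].
apply: le_trans (@vwp_term_ge 0 _ _ _); last exact: kM.
by rewrite mulr_ge0 ?even_weight_ge0// exprn_ge0// subrr.
Unshelve. all: by end_near. Qed.

(** Squeeze: the previous lemma bounds the partial sums from above, and
    [vwp_term_le] bounds them from below by the terminating sums, up to the
    factor (a q^3 p^N;p)_N, which tends to 1. *)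
Lemma cvg_even_weight : series (even_weight q a) @ \oo --> S_oo.
Proof.
have R1 : (fun N => qpoch (a * q ^+ 3 * p ^+ N) p N) @ \oo --> (1 : R).
  apply: (@squeeze_cvgr _ _ _ _ (fun N => 1 - a * q ^+ 3 * p ^+ N / (1 - p))
    (fun=> 1)); last exact: cvg_cst.
    by near=> N; rewrite qpoch_ge// qpoch_le1.
  rewrite -[X in _ --> X]subr0 -(mul0r (1 - p)^-1) -(mulr0 (a * q ^+ 3)).
  apply: cvgB; first exact: cvg_cst.
  by apply: cvgMl; apply: cvgMr; apply: cvg_expr; rewrite ger0_norm// ltW.
rewrite -(cvg_shiftS (series (even_weight q a))).
apply: (@squeeze_cvgr _ _ _ _
  (fun N => qpoch (a * q ^+ 3) p N / qpoch q p N *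
            qpoch (a * q ^+ 3 * p ^+ N) p N) (fun=> S_oo)).
- near=> N; rewrite even_weight_sum_le andbT -sum_vwp_term.
  rewrite -ler_pdivlMr ?qpoch_gt0// mulr_suml; apply: ler_sum_nat => k /andP[_].
  by rewrite ltnS => kN; exact: vwp_term_le.
- by rewrite -[X in _ --> X]mulr1; exact: cvgM cvg_sum_vwp_term R1.
- exact: cvg_cst.
Unshelve. all: by end_near. Qed.

End EvenWeightSum.

(** * The two weights as one function of the lattice index *)

Section Weights.
Context {R : realType}.
Implicit Types (q a u : R) (f g : nat -> R).

(** A series whose first i terms vanish has the sum of its shift by i. *)
Lemma cvg_series_shift f g i (l : R) :
  (forall k, (k < i)%N -> f k = 0) -> (forall k, f (k + i)%N = g k) ->
  series g @ \oo --> l -> series f @ \oo --> l.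
Proof.
move=> f0 fg gl; rewrite -(cvg_shiftn i).
rewrite (_ : (fun n => _) = series g)//; apply/funext => n.
rewrite /series/= (@big_cat_nat _ _ _ i)//= ?leq_addl//.
rewrite big_nat big1 ?add0r; last by move=> k /andP[_ /f0].
by rewrite -{1}[i]add0n big_addn addnK; apply: eq_bigr => k _.
Qed.

(** The common form of the two weights, as a function of the lattice index:
    the even and the odd weight are its restrictions to the even and to the
    odd indices. *)
Definition dweight q a x : R :=
  if x is y.+1 then
    (1 - a * q ^+ (2 * x + 1)) * qpoch (a * q ^+ 2) q y / qpoch q q x
    * q ^+ 'C(x, 2)
  else 1.

Lemma even_weightE q a k : even_weight q a k = dweight q a (2 * k).
Proof.
rewrite /even_weight; case: k => [|k].
  by rewrite /= !muln0 qpoch0 expr0 invr1 !mulr1.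
rewrite /even_num (mulnS 2) add2n /dweight.
have -> : 'C((2 * k).+2, 2) = (k.+1 * ((2 * k).+2 - 1))%N.
  rewrite bin2 -[(2 * k).+2]/(2 + 2 * k)%N -mulnS -mulnA (mul2n (_ * _))
    doubleK.
  by congr (_ * _)%N; lia.
have -> : (2 * (2 * k).+2 + 1 = 4 * k.+1 + 1)%N by lia.
by [].
Qed.

Lemma odd_weightE q a k : odd_weight q a k = dweight q a (2 * k + 1).
Proof.
rewrite /odd_weight /odd_num addn1 /dweight.
have -> : 'C((2 * k).+1, 2) = (k * (2 * k).+1)%N.
  by rewrite bin2 /= mulnCA (mul2n (_ * _)) doubleK mulnC.
by have -> : (2 * (2 * k).+1 + 1 = 4 * k + 3)%N by lia.
Qed.

(** The step j = 1 of [dweight_shift]. *)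
Lemma dweight_shift1 q a y : 0 < q -> q < 1 ->
  dweight q a y.+1 * ((1 - q ^- y.+1) * (1 - a * q ^+ y.+2)) =
  - q^-1 * ((1 - a * q ^+ 2) * (1 - a * q ^+ 3)) * dweight q (a * q ^+ 2) y.
Proof.
move=> q0 q1; have q0' : q != 0 by rewrite gt_eqF.
have qn n : 1 - q ^+ n.+1 != 0 by rewrite gt_eqF// subr_gt0 exprn_ilt1// ltW.
case: y => [|y].
  rewrite /dweight !qpochS !qpoch0 bin2 expr0; field.
  by have := qn 0%N; rewrite expr1 q0' => ->.
have e : qpoch (a * q ^+ 2) q y.+2 =
  (1 - a * q ^+ 2) * (1 - a * q ^+ 3) * qpoch (a * q ^+ 2 * q ^+ 2) q y.
  by rewrite 2!qpochSl mulrA; congr (_ * (1 - _) * qpoch _ _ _); ring.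
have e' : qpoch (a * q ^+ 2) q y.+2 =
  qpoch (a * q ^+ 2) q y.+1 * (1 - a * q ^+ y.+3).
  by rewrite qpochS -mulrA -exprD add2n.
rewrite /dweight; rewrite e' in e.
have C0 : qpoch q q y.+1 != 0 by rewrite qpoch_neq0.
rewrite [qpoch q q y.+2]qpochS -[q * q ^+ _]exprS.
transitivity (qpoch (a * q ^+ 2) q y.+1 * (1 - a * q ^+ y.+3) *
  ((1 - a * q ^+ (2 * y.+2 + 1)) / (qpoch q q y.+1 * (1 - q ^+ y.+2))
   * q ^+ 'C(y.+2, 2) * (1 - q ^- y.+2))); first by ring.
rewrite e.
have -> : q ^+ (2 * y.+2 + 1) = q ^+ 2 * q ^+ (2 * y.+1 + 1).
  by rewrite -exprD; congr (_ ^+ _); lia.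
have -> : q ^+ 'C(y.+2, 2) = q ^+ 'C(y.+1, 2) * q ^+ y.+2 * q^-1.
  by rewrite binS bin1 exprD [q ^+ y.+2]exprSr -!mulrA divff// mulr1.
by field; rewrite qn C0 q0' expf_neq0.
Qed.

(** Multiplying the weight by (q^(-x);q)_j (a q^(x+1);q)_j, where x = y + j,
    yields a multiple of the weight with parameter a q^(2j) at y. *)
Lemma dweight_shift q a j y : 0 < q -> q < 1 ->
  dweight q a (y + j) *
    (qpoch (q ^- (y + j)) q j * qpoch (a * q ^+ (y + j).+1) q j) =
  (-1) ^+ j * q ^- j * qpoch (a * q ^+ 2) q (2 * j)
    * dweight q (a * q ^+ (2 * j)) y.
Proof.
move=> q0 q1; have q0' : q != 0 by rewrite gt_eqF.
elim: j y => [|j IH] y.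
  by rewrite addn0 muln0 !qpoch0 !expr0 invr1 !mulr1 !mul1r.
rewrite [in LHS]qpochS [qpoch (a * _) q j.+1]qpochS addnS -addSn.
set X := qpoch _ _ _; set Y := qpoch _ _ _.
have -> : q ^- (y.+1 + j) * q ^+ j = q ^- y.+1.
  by rewrite exprD invfM mulfVK// expf_neq0.
have -> : a * q ^+ (y.+1 + j).+1 * q ^+ j = a * q ^+ (2 * j) * q ^+ y.+2.
  by rewrite -2!mulrA -![q ^+ _ * _]exprD; congr (a * q ^+ _); lia.
have -> : dweight q a (y.+1 + j)
  * (X * (1 - q ^- y.+1) * (Y * (1 - a * q ^+ (2 * j) * q ^+ y.+2))) =
  dweight q a (y.+1 + j) * (X * Y)
    * ((1 - q ^- y.+1) * (1 - a * q ^+ (2 * j) * q ^+ y.+2)) by ring.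
rewrite IH -[LHS]mulrA dweight_shift1//.
have -> : a * q ^+ (2 * j) * q ^+ 2 = a * q ^+ (2 * j.+1).
  by rewrite -mulrA -[q ^+ _ * _]exprD addnC -(mulnS 2).
have -> : qpoch (a * q ^+ 2) q (2 * j.+1) = qpoch (a * q ^+ 2) q (2 * j) *
    ((1 - a * q ^+ (2 * j.+1)) * (1 - a * q ^+ (2 * j) * q ^+ 3)).
  have -> : (2 * j.+1 = (2 * j).+2)%N by lia.
  rewrite !qpochS -[q ^+ (2 * j).+2]/(q ^+ (2 + 2 * j)) exprD.
  by rewrite [q ^+ (2 * j).+1]exprS; ring.
by rewrite [(-1) ^+ j.+1]exprS [q ^+ j.+1]exprS invfM; ring.
Qed.

End Weights.

(** * The sum of the odd weights, and moments *)

Section OddWeightSum.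
Context {R : realType}.

(** The alternating sum of [dweight] telescopes. *)
Lemma sum_even_sub_odd (q a : R) N : 0 < q -> q < 1 ->
  \sum_(0 <= k < N.+1) (even_weight q a k - odd_weight q a k) =
  - (qpoch (a * q ^+ 2) q (2 * N).+1 / qpoch q q (2 * N).+1)
  * q ^+ (N.+1 * (2 * N).+1).
Proof.
move=> q0 q1.
have qn n : 1 - q ^+ n.+1 != 0 by rewrite gt_eqF// subr_gt0 exprn_ilt1// ltW.
elim: N => [|N IH].
  rewrite big_nat1 /even_weight /odd_weight /even_num
    /odd_num !muln0 !qpochS !qpoch0.
  rewrite !expr0 !expr1; field.
  by have := qn 0%N; rewrite expr1.
rewrite big_nat_recr//= IH /even_weight /odd_weight /even_num /odd_num.
pose B := qpoch (a * q ^+ 2) q (2 * N).+1; pose C := qpoch q q (2 * N).+1.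
pose K := q ^+ (2 * N); pose E := q ^+ (N.+1 * (2 * N).+1).
have C0 : C != 0 by rewrite qpoch_neq0.
have -> : (2 * N.+1 + 1 = (2 * N).+3)%N by lia.
have -> : (2 * N.+1 = (2 * N).+2)%N by lia.
have -> : q ^+ (4 * N.+1 + 1) = q ^+ 5 * K ^+ 2.
  by rewrite /K -exprM -exprD; congr (q ^+ _); lia.
have -> : q ^+ (4 * N.+1 + 3) = q ^+ 7 * K ^+ 2.
  by rewrite /K -exprM -exprD; congr (q ^+ _); lia.
have -> : q ^+ (N.+1 * ((2 * N).+2 - 1)) = E by congr (q ^+ _); lia.
have -> : q ^+ (N.+1 * (2 * N).+3) = E * (q ^+ 2 * K).
  by rewrite /E /K -!exprD; congr (q ^+ _); nia.
have -> : q ^+ (N.+2 * (2 * N).+3) = E * (q ^+ 5 * K ^+ 2).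
  by rewrite /E /K -exprM -!exprD; congr (q ^+ _); nia.
have -> : qpoch q q (2 * N).+3 = C * (1 - q ^+ 2 * K) * (1 - q ^+ 3 * K).
  by rewrite 2!qpochS -/C /K !exprS expr0 mulr1 !mulrA.
have -> : qpoch q q (2 * N).+2 = C * (1 - q ^+ 2 * K).
  by rewrite qpochS -/C /K !exprS expr0 mulr1 !mulrA.
have -> : qpoch (a * q ^+ 2) q (2 * N).+3 =
  B * (1 - a * q ^+ 3 * K) * (1 - a * q ^+ 4 * K).
  by rewrite 2!qpochS -/B /K !exprS expr0 mulr1 !mulrA.
have -> : qpoch (a * q ^+ 2) q (2 * N).+2 = B * (1 - a * q ^+ 3 * K).
  by rewrite qpochS -/B /K !exprS expr0 mulr1 !mulrA.
rewrite -/B -/C; field.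
by rewrite C0 /K -!exprD !qn.
Qed.

Context (q a : R) (q_gt0 : 0 < q) (q_lt1 : q < 1).
Context (a_gt0 : 0 < a) (a_lt : a < q ^- 2).

Let p := q ^+ 2.
Let q0 : q != 0. Proof. by rewrite gt_eqF. Qed.
Let q_ge0 : 0 <= q. Proof. exact: ltW. Qed.
Let p_gt0 : 0 < p. Proof. exact: q2_gt0. Qed.
Let aqn_ge0 n : 0 <= a * q ^+ n.
Proof. by rewrite mulr_ge0// ?exprn_ge0// ltW. Qed.

Lemma cvg_odd_weight :
  series (odd_weight q a) @ \oo --> qpoch_inf (a * q ^+ 3) p / qpoch_inf q p.
Proof.
have c0 : 0 < qpoch_inf q q by rewrite qpoch_inf_gt0.
have h : (fun N => \sum_(0 <= k < N.+1) (even_weight q a k - odd_weight q a k))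
  @ \oo --> (0 : R).
  have h1 : (fun N => (qpoch_inf q q)^-1 * q ^+ N) @ \oo --> (0 : R).
    rewrite -[X in _ --> X](mulr0 (qpoch_inf q q)^-1); apply: cvgMr.
    by apply: cvg_expr; rewrite ger0_norm.
  apply: (@squeeze_cvgr _ _ _ _ (fun N => - ((qpoch_inf q q)^-1 * q ^+ N))
    (fun=> 0)); last exact: cvg_cst.
    near=> N; rewrite sum_even_sub_odd// mulNr oppr_le0 lerN2.
    have B1 := @qpoch_le1 _ (a * q ^+ 2) q (2 * N).+1 q_gt0 q_lt1 (aqn_ge0 2)
      (@aqn_lt1 _ _ _ q_gt0 q_lt1 a_gt0 a_lt 2 isT).
    have B0 : 0 < qpoch (a * q ^+ 2) q (2 * N).+1 by rewrite qpoch_gt0//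
      (@aqn_lt1 _ q).
    have C0 : 0 < qpoch q q (2 * N).+1 by rewrite qpoch_gt0.
    rewrite mulr_ge0 ?divr_ge0 ?exprn_ge0 ?(ltW B0) ?(ltW C0)// andbT.
    apply: ler_pM; rewrite ?divr_ge0 ?exprn_ge0 ?(ltW B0) ?(ltW C0)//.
      rewrite -[leRHS]mul1r ler_pM// ?invr_ge0 ?(ltW B0) ?(ltW C0)//.
      by rewrite lef_pV2// qpoch_inf_le.
    by apply: ler_wiXn2l => //; [exact: ltW|clear; nia].
  by rewrite -oppr0; apply: cvgN.
rewrite -(cvg_shiftS (series (odd_weight q a))).
have e := cvg_even_weight q_gt0 q_lt1 a_gt0 a_lt.
rewrite -cvg_shiftS in e.
have -> : (fun N => series (odd_weight q a) N.+1) =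
  (fun N => series (even_weight q a) N.+1) -
  (fun N => \sum_(0 <= k < N.+1) (even_weight q a k - odd_weight q a k)).
  by apply/funext => N; rewrite !fctE /series/= sumrB opprB addrC subrK.
by have := cvgB e h; rewrite subr0; exact.
Unshelve. all: by end_near. Qed.

End OddWeightSum.

Section Moments.
Context {R : realType}.
Context (q a : R) (q_gt0 : 0 < q) (q_lt1 : q < 1).
Context (a_gt0 : 0 < a) (a_lt : a < q ^- 2).

Let p := q ^+ 2.
Let q0 : q != 0. Proof. by rewrite gt_eqF. Qed.
Let q_ge0 : 0 <= q. Proof. exact: ltW. Qed.
Let p_gt0 : 0 < p. Proof. exact: q2_gt0. Qed.
Let p_lt1 : p < 1. Proof. exact: q2_lt1. Qed.
Let aqn_ge0 n : 0 <= a * q ^+ n.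
Proof. by rewrite mulr_ge0// ?exprn_ge0// ltW. Qed.

(** The polynomial in mu whose value at the lattice point of index x is
    (q^(-x); q)_j (a q^(x+1); q)_j. *)
Definition phi_poly j : {poly R} :=
  \prod_(0 <= i < j) ((1 + a * q ^+ (2 * i + 1))%:P - q ^+ i *: 'X).

Lemma phi_polyE j x : (phi_poly j).[qlattice q a x] =
  qpoch (q `^ (- x)) q j * qpoch (a * q `^ (x + 1)) q j.
Proof.
rewrite qpoch_lattice// /phi_poly horner_prod; apply: eq_bigr => i _.
by rewrite hornerD hornerN hornerZ hornerC hornerX.
Qed.

Lemma phi_poly_nat j x : (phi_poly j).[qlattice q a x%:R] =
  qpoch (q ^- x) q j * qpoch (a * q ^+ x.+1) q j.
Proof. by rewrite phi_polyE natr1 powRN !powR_mulrn. Qed.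

(** The moments of P with respect to the even and to the odd measure both
    exist and are equal to l. *)
Definition has_moment (P : {poly R}) (l : R) :=
  series (fun k => even_weight q a k * P.[qlattice q a (2 * k)%:R])
    @ \oo --> l /\
  series (fun k => odd_weight q a k * P.[qlattice q a (2 * k + 1)%:R])
    @ \oo --> l.

Let S_oo := qpoch_inf (a * q ^+ 3) p / qpoch_inf q p.

Lemma cvg_seriesMr (c l : R) (f : nat -> R) :
  series f @ \oo --> l -> series (fun k => c * f k) @ \oo --> c * l.
Proof.
have -> : series (fun k => c * f k) = (fun n => c * series f n).
  by apply/funext => n; rewrite /series/= mulr_sumr.
exact: cvgMr.
Qed.

Lemma has_moment0 : has_moment 0 0.
Proof.
by split; under eq_fun do rewrite horner0 mulr0; rewrite /series/=;
   under eq_fun do rewrite big1//; exact: cvg_cst.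
Qed.

Lemma has_momentD P Q l m :
  has_moment P l -> has_moment Q m -> has_moment (P + Q) (l + m).
Proof.
move=> [P1 P2] [Q1 Q2]; split.
  under eq_fun do rewrite hornerD mulrDr.
  by rewrite -[X in series X]/((fun k => _) + (fun k => _)) seriesD;
    exact: cvgD.
under eq_fun do rewrite hornerD mulrDr.
by rewrite -[X in series X]/((fun k => _) + (fun k => _)) seriesD; exact: cvgD.
Qed.

Lemma has_momentZ c P l : has_moment P l -> has_moment (c *: P) (c * l).
Proof.
move=> [P1 P2]; split; under eq_fun do rewrite hornerZ mulrCA.
  exact: cvg_seriesMr P1.
exact: cvg_seriesMr P2.
Qed.

Lemma has_moment_sum n (c : nat -> R) (P : nat -> {poly R}) (l : nat -> R) :
  (forall j, has_moment (P j) (l j)) ->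
  has_moment (\sum_(0 <= j < n) c j *: P j) (\sum_(0 <= j < n) c j * l j).
Proof.
move=> Pl; elim: n => [|n IH]; first by rewrite !big_nil; exact: has_moment0.
by rewrite !big_nat_recr//=; apply: has_momentD IH _; exact: has_momentZ.
Qed.

(** Both moments reduce by [dweight_shift] to the total mass for a q^(2j), on
    the lattice of the same parity if j is even and of the opposite parity if
    j is odd. *)
Lemma has_moment_phi j :
  has_moment (phi_poly j) ((-1) ^+ j * q ^- j * qpoch (a * q ^+ 2) p j * S_oo).
Proof.
pose A := a * q ^+ (2 * j).
have A_gt0 : 0 < A by rewrite mulr_gt0// exprn_gt0.
have A_lt : A < q ^- 2.
  by apply: le_lt_trans a_lt; rewrite ler_piMr ?(ltW a_gt0)// exprn_ile1// ltW.
pose c := (-1) ^+ j * q ^- j * qpoch (a * q ^+ 2) q (2 * j).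
have -> : (-1) ^+ j * q ^- j * qpoch (a * q ^+ 2) p j * S_oo =
          c * (qpoch_inf (A * q ^+ 3) p / qpoch_inf q p).
  rewrite /c /S_oo (@qpoch_infD _ (a * q ^+ 3) p j)//; last exact: aqn_lt1.
  rewrite qpoch_double -[a * q ^+ 2 * q]mulrA -exprSr.
  have -> : A * q ^+ 3 = a * q ^+ 3 * p ^+ j by rewrite /A /p -exprM mulrAC.
  by rewrite -/p; ring.
have phi0 x : (x < j)%N -> (phi_poly j).[qlattice q a x%:R] = 0.
  by move=> xj; rewrite phi_poly_nat qpoch_eq0// mul0r.
have shift y x : (x = y + j)%N ->
    dweight q a x * (phi_poly j).[qlattice q a x%:R] = c * dweight q A y.
  by move=> ->; rewrite phi_poly_nat dweight_shift.
have evenA : series (fun k => c * even_weight q A k) @ \oo --> c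
  * (qpoch_inf (A * q ^+ 3) p / qpoch_inf q p).
  by apply: cvg_seriesMr; exact: cvg_even_weight.
have oddA : series (fun k => c * odd_weight q A k) @ \oo --> c
  * (qpoch_inf (A * q ^+ 3) p / qpoch_inf q p).
  by apply: cvg_seriesMr; exact: cvg_odd_weight.
have jE := odd_double_half j; move: jE; rewrite -muln2 mulnC;
  case: (odd j) => /= jE.
- split.
  + apply: (cvg_series_shift (i := j./2.+1) _ _ oddA) => k.
      by move=> ki; rewrite phi0 ?mulr0//; move: ki jE; clear; lia.
    by rewrite even_weightE odd_weightE; apply: shift; move: jE; clear; lia.
  + apply: (cvg_series_shift (i := j./2) _ _ evenA) => k.
      by move=> ki; rewrite phi0 ?mulr0//; move: ki jE; clear; lia.
    by rewrite even_weightE odd_weightE; apply: shift; move: jE; clear; lia.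
- split.
  + apply: (cvg_series_shift (i := j./2) _ _ evenA) => k.
      by move=> ki; rewrite phi0 ?mulr0//; move: ki jE; clear; lia.
    by rewrite !even_weightE; apply: shift; move: jE; clear; lia.
  + apply: (cvg_series_shift (i := j./2) _ _ oddA) => k.
      by move=> ki; rewrite phi0 ?mulr0//; move: ki jE; clear; lia.
    by rewrite !odd_weightE; apply: shift; move: jE; clear; lia.
Qed.

End Moments.

(** * Three-term recurrence and orthogonality *)

Section Orthogonality.
Context {R : realType}.
Context (q a : R) (q_gt0 : 0 < q) (q_lt1 : q < 1).
Context (a_gt0 : 0 < a) (a_lt : a < q ^- 2).

Let p := q ^+ 2.
Let q0 : q != 0. Proof. by rewrite gt_eqF. Qed.
Let p_gt0 : 0 < p. Proof. exact: q2_gt0. Qed.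
Let p_lt1 : p < 1. Proof. exact: q2_lt1. Qed.
Let aqn_neq0 n : (2 <= n)%N -> 1 - a * q ^+ n != 0.
Proof. by move=> n2; rewrite gt_eqF// subr_gt0 (@aqn_lt1 _ q). Qed.
Let qn_neq0 n : 1 - q ^+ n.+1 != 0.
Proof. by rewrite gt_eqF// subr_gt0 qn_lt1. Qed.

(** For u = q^n this is (q^(-n);q)_j (- q^n)^j, written as a polynomial in u. *)
Definition gfac (u : R) j : R := \prod_(0 <= i < j) (q ^+ i - u).

Lemma gfac0 u : gfac u 0 = 1. Proof. by rewrite /gfac big_nil. Qed.

Lemma gfacS u j : gfac u j.+1 = gfac u j * (q ^+ j - u).
Proof. by rewrite /gfac big_nat_recr. Qed.

Lemma gfac_scale u j : gfac (q * u) j.+1 = q ^+ j * (1 - q * u) * gfac u j.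
Proof.
elim: j => [|j IH]; first by rewrite gfacS !gfac0 expr0; ring.
by rewrite gfacS IH [gfac u j.+1]gfacS exprS; ring.
Qed.

Lemma gfac_eq0 n j : (n < j)%N -> gfac (q ^+ n) j = 0.
Proof.
by move=> nj; rewrite /gfac big_mkord (bigD1 (Ordinal nj))//= subrr mul0r.
Qed.

(** The denominators of the expansion of D_n in the polynomials [phi_poly];
    (a q^2;q^2)_j is the product of the two denominators with square roots. *)
Definition dden j : R := qpoch (a * q ^+ 2) p j * qpoch q q j.

Lemma dden0 : dden 0 = 1. Proof. by rewrite /dden !qpoch0 mulr1. Qed.

Lemma ddenS j : dden j.+1 =
  dden j * ((1 - a * q ^+ 2 * q ^+ (2 * j)) * (1 - q ^+ j.+1)).
Proof. by rewrite /dden !qpochS -exprM -exprS; ring. Qed.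

Lemma dden_neq0 j : dden j != 0.
Proof. by rewrite mulf_neq0// qpoch_neq0// aq2_lt1. Qed.

(** For u = q^n this is the coefficient of [phi_poly q a j] in D_n. *)
Definition dcoef u j : R := q ^+ j * gfac u j / dden j.

Lemma dcoef_eq0 n j : (n < j)%N -> dcoef (q ^+ n) j = 0.
Proof. by move=> nj; rewrite /dcoef gfac_eq0// mulr0 mul0r. Qed.

Lemma dcoefE n j : dcoef (q ^+ n) j =
  qpoch (q ^- n) q j * (- q ^+ n.+1) ^+ j /
  (qpoch (Num.sqrt a * q) q j * qpoch (- Num.sqrt a * q) q j * qpoch q q j).
Proof.
rewrite /dcoef /dden; congr (_ / (_ * _)).
  elim: j => [|j IH]; first by rewrite gfac0 qpoch0 !expr0.
  rewrite gfacS qpochS 2!exprS.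
  have -> : q * q ^+ j * (gfac (q ^+ n) j * (q ^+ j - q ^+ n)) =
    q ^+ j * gfac (q ^+ n) j * (q * (q ^+ j - q ^+ n)) by ring.
  rewrite IH exprS; field; exact: expf_neq0.
elim: j => [|j IH]; first by rewrite !qpoch0 mulr1.
rewrite !qpochS IH.
have -> : a * q ^+ 2 * p ^+ j = (Num.sqrt a * q * q ^+ j) ^+ 2.
  by rewrite !exprMn sqr_sqrtr ?(ltW a_gt0)// /p -!exprM mulnC.
by ring.
Qed.

Lemma dual_qultra_expand n M : (n < M)%N ->
  dual_qultra q a n = \sum_(0 <= j < M) dcoef (q ^+ n) j *: phi_poly q a j.
Proof.
move=> nM; apply/esym/dual_qultra_unique => // x.
rewrite (@big_cat_nat _ _ _ n.+1)//=
  [X in _ + X]big_nat_cond [X in _ + X]big1 ?addr0; last first.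
  by move=> j /andP[/andP[nj _] _]; rewrite dcoef_eq0// scale0r.
rewrite phi32_terminating// horner_sum; apply: eq_bigr => j _.
by rewrite hornerZ phi_polyE// dcoefE /phi32_term; ring.
Qed.

Lemma dual_qultra0 : dual_qultra q a 0 = 1.
Proof.
rewrite (dual_qultra_expand (ltnSn 0)) big_nat1 /dcoef gfac0 dden0.
by rewrite /phi_poly big_nil expr0 mulr1 divr1 scale1r.
Qed.

Lemma mulX_phi_poly j : 'X * phi_poly q a j =
  q ^- j *: ((1 + a * q ^+ (2 * j + 1)) *: phi_poly q a j - phi_poly q a j.+1).
Proof.
have qj : q ^+ j != 0 by rewrite expf_neq0.
have -> : phi_poly q a j.+1 =
    (1 + a * q ^+ (2 * j + 1)) *: phi_poly q a j - q ^+ j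
      *: ('X * phi_poly q a j).
  rewrite /phi_poly big_nat_recr//= mulrC mulrBl mul_polyC.
  by rewrite -scalerAl.
by rewrite opprB addrC subrK scalerA mulVf// scale1r.
Qed.

(** The coefficients of the three-term recurrence in n. *)
Definition recA n : R := - (1 - a * q ^+ (2 * n + 2)) / q ^+ (2 * n + 1).
Definition recB n : R := (1 + q^-1) / q ^+ (2 * n).
Definition recC n : R := - (1 - q ^+ (2 * n)) / q ^+ (2 * n).

Lemma recA_neq0 n : recA n != 0.
Proof. by rewrite mulf_neq0 ?oppr_eq0 ?invr_eq0 ?expf_neq0// aqn_neq0//
  leq_addl. Qed.

(** The three-term recurrence, coefficientwise in the basis [phi_poly].  At
    n = 0 the term in n.-1 is harmless, as [recC 0] vanishes. *)
Lemma dcoef_rec n j :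
  q ^- j * (1 + a * q ^+ (2 * j + 1)) * dcoef (q ^+ n) j
  - (if j is i.+1 then q ^- i * dcoef (q ^+ n) i else 0) =
  recA n * dcoef (q ^+ n.+1) j + recB n * dcoef (q ^+ n) j
  + recC n * dcoef (q ^+ n.-1) j.
Proof.
have qn m : q ^+ m != 0 by rewrite expf_neq0.
have recE : [/\ recA n = - (1 - a * q ^+ 2 * (q ^+ n) ^+ 2)
  / (q * (q ^+ n) ^+ 2),
    recB n = (1 + q^-1) / (q ^+ n) ^+ 2 & recC n =
      - (1 - (q ^+ n) ^+ 2) / (q ^+ n) ^+ 2].
  rewrite /recA /recB /recC -!exprM (mulnC n) -exprS addn1; split => //.
  by rewrite [in LHS]addnC exprD mulrA.
case: recE => -> -> ->.
case: j => [|i].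
  rewrite /dcoef !gfac0 dden0 expr0 muln0 add0n expr1; field.
  by rewrite q0 qn.
have C : - (1 - (q ^+ n) ^+ 2) / (q ^+ n) ^+ 2 * dcoef (q ^+ n.-1) i.+1 =
   - (1 + q ^+ n) / (q ^+ n) ^+ 2 * (gfac (q ^+ n) i.+2 / dden i.+1).
  case: n => [|n] /=.
    rewrite !expr0 expr1n subrr oppr0 !mul0r.
    by have := @gfac_eq0 0 i.+2 isT; rewrite expr0 => ->; rewrite mul0r mulr0.
  rewrite [q ^+ n.+1]exprS gfac_scale -exprS /dcoef; field.
  by rewrite dden_neq0 qn.
rewrite C /dcoef [q ^+ n.+1]exprS gfac_scale !gfacS ddenS.
have -> : q ^+ (2 * i.+1 + 1) = q ^+ 3 * (q ^+ i) ^+ 2.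
  by rewrite -exprM -exprD; congr (q ^+ _); lia.
have -> : q ^+ (2 * i) = (q ^+ i) ^+ 2 by rewrite -exprM mulnC.
have h1 : 1 - a * q ^+ 2 * (q ^+ i) ^+ 2 != 0.
  by rewrite -exprM -mulrA -exprD aqn_neq0.
have h2 : 1 - q * q ^+ i != 0 by rewrite -exprS.
rewrite !exprSr; field.
by rewrite mulrC h2 -!expr2 h1 dden_neq0 !qn q0.
Qed.

Lemma dual_qultra_rec n : 'X * dual_qultra q a n =
  recA n *: dual_qultra q a n.+1 + recB n *: dual_qultra q a n
  + recC n *: dual_qultra q a n.-1.
Proof.
rewrite (@dual_qultra_expand n.+1 n.+2)// (@dual_qultra_expand n.-1 n.+2);
  last by lia.
rewrite (@dual_qultra_expand n n.+2)// !scaler_sumr -!big_split/=.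
transitivity (\sum_(0 <= j < n.+2)
  (q ^- j * (1 + a * q ^+ (2 * j + 1)) * dcoef (q ^+ n) j
  - (if j is i.+1 then q ^- i * dcoef (q ^+ n) i else 0)) *: phi_poly q a j);
    last first.
  by apply: eq_bigr => j _; rewrite dcoef_rec !scalerA -!scalerDl.
under [RHS]eq_bigr do rewrite scalerBl.
rewrite sumrB [X in _ = _ - X]big_nat_recl// scale0r add0r.
rewrite mulr_sumr big_nat_recr//= dcoef_eq0// scale0r mulr0 addr0.
rewrite [X in _ = X - _]big_nat_recr//= dcoef_eq0// mulr0 scale0r addr0.
rewrite -sumrB; apply: eq_bigr => j _.
rewrite -scalerAr mulX_phi_poly !scalerBr !scalerA.
by congr (_ *: _ - _ *: _); ring.
Qed.

Let S_oo := qpoch_inf (a * q ^+ 3) p / qpoch_inf q p.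

(** The partial sums of the terminating q-binomial series; for u = q^n and
    m = n > 0 the product on the right contains a zero factor. *)
Lemma sum_gfac u m :
  \sum_(0 <= j < m.+1) (-1) ^+ j * gfac u j / qpoch q q j =
  (-1) ^+ m * (\prod_(0 <= i < m) (q ^+ i.+1 - u)) / qpoch q q m.
Proof.
elim: m => [|m IH]; first by rewrite big_nat1 gfac0 big_nil.
rewrite big_nat_recr//= IH big_nat_recr//= qpochS -exprS.
have -> : gfac u m.+1 = (1 - u) * \prod_(0 <= i < m) (q ^+ i.+1 - u).
  by rewrite /gfac big_nat_recl// expr0.
by rewrite exprS; field; rewrite qn_neq0 qpoch_neq0.
Qed.

Lemma has_moment_dual_qultra n :
  has_moment q a (dual_qultra q a n) (S_oo * (n == 0%N)%:R).
Proof.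
rewrite (dual_qultra_expand (ltnSn n)).
have := has_moment_sum n.+1 (dcoef (q ^+ n))
  (fun j => has_moment_phi q_gt0 q_lt1 a_gt0 a_lt j).
congr (has_moment _ _ _ _).
transitivity (S_oo * \sum_(0 <= j < n.+1) (-1) ^+ j * gfac (q ^+ n) j
  / qpoch q q j).
  rewrite mulr_sumr; apply: eq_bigr => j _.
  rewrite /dcoef /dden -/p -/S_oo; field.
  rewrite expf_neq0// !qpoch_neq0//; exact: aq2_lt1.
congr (_ * _); rewrite sum_gfac; case: n => [|n].
  by rewrite big_nil qpoch0 !mulr1 divr1.
by rewrite big_nat_recr//= subrr !(mulr0, mul0r).
Qed.

(** The squared norm of D_n. *)
Definition dnorm n : R :=
  S_oo * (qpoch p p n * q ^- n / qpoch (a * q ^+ 2) p n).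

(** Symmetry of the recurrence with respect to the weights 1/h_n. *)
Lemma dnormS n : recA n * dnorm n.+1 = recC n.+1 * dnorm n.
Proof.
rewrite /dnorm !qpochS /recA /recC -/p.
have -> : (2 * n.+1 = 2 * n + 2)%N by lia.
have -> : a * q ^+ 2 * p ^+ n = a * q ^+ (2 * n + 2).
  by rewrite /p -exprM -mulrA -exprD addnC.
have -> : p * p ^+ n = q ^+ (2 * n + 2) by rewrite -exprS /p -exprM mulnS addnC.
have h := aqn_neq0 (leq_addl (2 * n) 2).
have -> : q ^+ (2 * n + 2) = q ^+ (2 * n + 1) * q by rewrite -exprSr addnS.
rewrite exprS; field.
rewrite qpoch_neq0 ?q0 ?expf_neq0 -?exprSr -?addnS ?h//; exact: aq2_lt1.
Qed.

(** Induction on m: the recurrence expresses D_(m+1) through mu D_m, and mu is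
    moved to the other factor D_n. *)
Lemma has_moment_dual_qultraM m n :
  has_moment q a (dual_qultra q a m * dual_qultra q a n)
    (dnorm n * (m == n)%:R).
Proof.
have [k] := ubnP m; elim: k m n => // k IH [|m] n mk.
  rewrite dual_qultra0 mul1r eq_sym.
  have := has_moment_dual_qultra n; case: n => [|n]; last by rewrite !mulr0.
  by rewrite /dnorm !qpoch0 expr0 invr1 !mulr1.
have m1 : (m < k)%N by lia.
have m2 : (m.-1 < k)%N by lia.
have := has_momentZ (recA m)^-1 (has_momentD (has_momentD (has_momentD
   (has_momentZ (recA n) (IH _ n.+1 m1))
     (has_momentZ (recB n - recB m) (IH _ n m1)))
   (has_momentZ (recC n) (IH _ n.-1 m1))) (has_momentZ (- recC m) (IH _ n m2))).
congr (has_moment _ _ _ _).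
  have -> : dual_qultra q a m.+1 = (recA m)^-1 *: ('X * dual_qultra q a m
     - recB m *: dual_qultra q a m - recC m *: dual_qultra q a m.-1).
    apply: (canRL (scalerK (recA_neq0 m))); rewrite dual_qultra_rec; ring.
  rewrite -scalerAl; congr (_ *: _).
  transitivity (dual_qultra q a m * ('X * dual_qultra q a n)
     - recB m *: dual_qultra q a m * dual_qultra q a n
     - recC m *: dual_qultra q a m.-1 * dual_qultra q a n); last by ring.
  by rewrite dual_qultra_rec -!mul_polyC polyCB polyCN; ring.
apply: (canLR (mulKf (recA_neq0 m))).
have C0 : recC 0 = 0 by rewrite /recC muln0 expr0 subrr oppr0 mul0r.
have [<-|mSn] := eqVneq m.+1 n.
  have /negPf-> : m != m.+2 by lia.
  have /negPf-> : m != m.+1 by lia.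
  have /negPf-> : m.-1 != m.+1 by lia.
  by rewrite /= !eqxx !(mulr0, mulr1n, mulr0n, mulr1, add0r, addr0) dnormS.
have [->|mnS] := eqVneq m n.+1.
  have /negPf-> : n.+1 != n by lia.
  have /negPf-> : n.+1 != n.-1 by lia.
  by rewrite /= !eqxx !(mulr0, mulr1n, mulr0n, mulr1, addr0) dnormS mulNr subrr.
have [<-|mn] := eqVneq m n.
  rewrite subrr !(mul0r, mulr0n, mulr0, add0r, addr0).
  case: (m) => [|k']; first by rewrite C0 oppr0 !mul0r addr0.
  have /negPf-> : k'.+1 != k'.+1.-1 by lia.
  have /negPf-> : k'.+1.-1 != k'.+1 by lia.
  by rewrite mulr0n !mulr0 addr0.
have /negPf-> : m != n.-1 by lia.
case: m {IH mk m1 m2} mSn mnS mn => [|m] mSn mnS mn.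
  by rewrite C0 oppr0 !(mulr0n, mulr0, mul0r, addr0).
have /negPf-> : m.+1.-1 != n by lia.
by rewrite !(mulr0n, mulr0, addr0).
Qed.

End Orthogonality.

(** * Recurrence in the lattice index and orthogonality of columns *)

Section DualRecurrence.
Context {R : realType}.
Context (q a : R) (q_gt0 : 0 < q) (q_lt1 : q < 1).
Context (a_gt0 : 0 < a) (a_lt : a < q ^- 2).

Let p := q ^+ 2.
Let q0 : q != 0. Proof. by rewrite gt_eqF. Qed.
Let p_gt0 : 0 < p. Proof. exact: q2_gt0. Qed.
Let p_lt1 : p < 1. Proof. exact: q2_lt1. Qed.
Let aqn_neq0 n : (2 <= n)%N -> 1 - a * q ^+ n != 0.
Proof. by move=> n2; rewrite gt_eqF// subr_gt0 (@aqn_lt1 _ q). Qed.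
Let qn_neq0 n : 1 - q ^+ n.+1 != 0.
Proof. by rewrite gt_eqF// subr_gt0 qn_lt1. Qed.
Let qX_neq0 n : q ^+ n != 0. Proof. by rewrite expf_neq0. Qed.

(** The value of [phi_poly] j at the lattice point with q^x = X. *)
Definition phi_val (X : R) j : R := qpoch X^-1 q j * qpoch (a * (q * X)) q j.

Lemma phi_valS X j : phi_val X j.+1 =
  phi_val X j * ((1 - q ^+ j / X) * (1 - a * q * X * q ^+ j)).
Proof. by rewrite /phi_val !qpochS; ring. Qed.

Lemma phi_val_up X j : X != 0 ->
  (1 - a * q * X) * phi_val (q * X) j.+1 =
  (1 - (q * X)^-1) * phi_val X j
  * ((1 - a * q * X * q ^+ j) * (1 - a * q ^+ 2 * X * q ^+ j)).
Proof.
move=> X0; rewrite /phi_val qpochSl.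
have -> : (q * X)^-1 * q = X^-1 by field; rewrite q0 X0.
have -> : (1 - a * q * X) *
  ((1 - (q * X)^-1) * qpoch X^-1 q j * qpoch (a * (q * (q * X))) q j.+1) =
  (1 - (q * X)^-1) * qpoch X^-1 q j * qpoch (a * (q * X)) q j.+2.
  rewrite [qpoch (a * (q * X)) _ _]qpochSl.
  have -> : a * (q * X) * q = a * (q * (q * X)) by ring.
  by ring.
by rewrite !qpochS exprS; ring.
Qed.

Lemma phi_val_down X j : X != 0 ->
  (1 - X) * phi_val (X / q) j.+1 =
  - X * phi_val X j * ((1 - q ^+ j / X) * (1 - q * q ^+ j / X) * (1 - a * X)).
Proof.
move=> X0; rewrite /phi_val.
have -> : a * (q * (X / q)) = a * X by field.
rewrite [qpoch (a * X) _ _]qpochSl.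
have -> : a * X * q = a * (q * X) by ring.
have -> : (X / q)^-1 = X^-1 * q by field; rewrite q0 X0.
have -> : (1 - X) * (qpoch (X^-1 * q) q j.+1
  * ((1 - a * X) * qpoch (a * (q * X)) q j)) =
  - X * qpoch X^-1 q j.+2 * ((1 - a * X) * qpoch (a * (q * X)) q j).
  by rewrite [qpoch X^-1 _ _]qpochSl; field.
by rewrite !qpochS exprS; ring.
Qed.

Lemma phi_val_eq0 x j : (x < j)%N -> phi_val (q ^+ x) j = 0.
Proof. by move=> xj; rewrite /phi_val qpoch_eq0// mul0r. Qed.

(** D_n at the lattice point of index x, as a function of u = q^n. *)
Definition dual_val (u : R) x : R :=
  \sum_(0 <= j < x.+1) dcoef q a u j * phi_val (q ^+ x) j.

Lemma dual_val_widen u x M : (x < M)%N ->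
  dual_val u x = \sum_(0 <= j < M) dcoef q a u j * phi_val (q ^+ x) j.
Proof.
move=> xM; rewrite (@big_cat_nat _ _ _ x.+1 0 M)//=.
rewrite [X in _ + X]big_nat_cond [X in _ + X]big1 ?addr0//.
by move=> j /andP[/andP[xj _] _]; rewrite phi_val_eq0// mulr0.
Qed.

Lemma dual_valE n x :
  (dual_qultra q a n).[qlattice q a x%:R] = dual_val (q ^+ n) x.
Proof.
rewrite (@dual_val_widen _ _ (maxn n x).+1) ?ltnS ?leq_maxr//.
rewrite (@dual_qultra_expand _ _ _ q_gt0 q_lt1 a_gt0 a_lt _ (maxn n x).+1) ?ltnS
  ?leq_maxl//.
rewrite horner_sum; apply: eq_bigr => j _.
by rewrite hornerZ phi_poly_nat// exprS.
Qed.

(** The recurrence in the lattice index: it has no term in [dual_val u x.+1]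
    without the factor u, which is why parity in u is preserved. *)
Lemma dual_val_rec u x :
  (1 - a * q * (q ^+ x.+1) ^+ 2) * (u * dual_val u x.+1) =
  q ^+ x.+1 * (1 - a * q * q ^+ x.+1) * dual_val u x.+2
  + (1 - q ^+ x.+1) * dual_val u x.
Proof.
rewrite (@dual_val_widen u x.+1 x.+3)// (@dual_val_widen u x.+2 x.+3)//.
rewrite (@dual_val_widen u x x.+3); last by lia.
have -> : q ^+ x = q ^+ x.+1 / q by rewrite exprSr mulfK.
rewrite [q ^+ x.+2]exprS; set X := q ^+ x.+1.
have X0 : X != 0 by exact: qX_neq0.
have phi0 : phi_val X x.+2 = 0 by exact: phi_val_eq0.
have uG j : u * dcoef q a u j =
    q ^+ j * dcoef q a u j - q ^+ j * gfac q u j.+1 / dden q a j.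
  by rewrite /dcoef gfacS; field; exact: dden_neq0.
rewrite [in LHS]mulr_sumr; under [in LHS]eq_bigr do rewrite mulrA uG mulrBl.
rewrite sumrB big_nat_recl// [X in _ * (_ - X)]big_nat_recr//= phi0 mulr0 addr0.
rewrite -addrA -sumrB !mulr_sumr -big_split/= [RHS]big_nat_recl//=
  [LHS]mulrDr mulr_sumr.
congr (_ + _).
  by rewrite /dcoef /phi_val gfac0 dden0 expr0 !qpoch0; field.
apply: eq_bigr => j _.
have -> : X * (1 - a * q * X) * (dcoef q a u j.+1 * phi_val (q * X) j.+1) =
  X * dcoef q a u j.+1 * ((1 - a * q * X) * phi_val (q * X) j.+1) by ring.
have -> : (1 - X) * (dcoef q a u j.+1 * phi_val (X / q) j.+1) =
  dcoef q a u j.+1 * ((1 - X) * phi_val (X / q) j.+1) by ring.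
rewrite phi_val_up// phi_val_down// phi_valS /dcoef ddenS//.
have -> : q ^+ (2 * j) = (q ^+ j) ^+ 2 by rewrite -exprM mulnC.
have h1 : 1 - a * q ^+ 2 * (q ^+ j) ^+ 2 != 0.
  by rewrite -exprM -mulrA -exprD aqn_neq0.
have h2 : 1 - q * q ^+ j != 0 by rewrite -exprS.
rewrite !exprS; field.
by rewrite X0 h2 -!expr2 h1 dden_neq0.
Qed.

Lemma dual_val0 u : dual_val u 0 = 1.
Proof.
rewrite /dual_val big_nat1 /dcoef gfac0 dden0 /phi_val !qpoch0 expr0.
by rewrite !mulr1 divr1.
Qed.

Lemma dual_val1 u : dual_val u 1 = u.
Proof.
rewrite /dual_val !big_nat_recr// big_nil /= /dcoef /phi_val ddenS// dden0.
rewrite !gfacS gfac0 !qpochS !qpoch0 muln0 !expr0 !expr1.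
have := qn_neq0 0; rewrite expr1 => h1; have h2 := aqn_neq0 (leqnn 2).
by field; rewrite q0 h1 h2.
Qed.

(** At the lattice point of index x, D_n is an even or an odd polynomial in
    u = q^n according to the parity of x. *)
Lemma dual_val_parity x : exists r : {poly R},
  forall u, dual_val u x = u ^+ odd x * r.[u ^+ 2].
Proof.
suff [] : (exists r : {poly R}, forall u, dual_val u x =
  u ^+ odd x * r.[u ^+ 2]) /\
  (exists r : {poly R}, forall u, dual_val u x.+1 =
    u ^+ odd x.+1 * r.[u ^+ 2]) by [].
elim: x => [|x [[r rE] [s sE]]].
  split; exists 1 => u; rewrite hornerC mulr1.
    by rewrite dual_val0 expr0.
  by rewrite dual_val1 expr1.
split; first by exists s.
pose X := q ^+ x.+1.
have X0 : X != 0 by exact: qX_neq0.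
have aX0 : 1 - a * q * X != 0 by rewrite /X -mulrA -exprS aqn_neq0.
have h : X * (1 - a * q * X) != 0 by rewrite mulf_neq0.
exists ((X * (1 - a * q * X))^-1 *:
  ((1 - a * q * X ^+ 2) *: ((if odd x then 1 else 'X) * s) - (1 - X) *: r)) =>
    u.
apply: (mulfI h); have := dual_val_rec u x;
  rewrite -/X => /esym/(canRL (addrK _)) ->.
rewrite rE sE !hornerE /= negbK; case: (odd x) => /=.
  by rewrite hornerC; field; rewrite X0 aX0.
by rewrite hornerX; field; rewrite X0 aX0.
Qed.

Let D n x : R := (dual_qultra q a n).[qlattice q a x%:R].

Let S_oo := qpoch_inf (a * q ^+ 3) p / qpoch_inf q p.

Lemma dnorm_gt0 n : 0 < dnorm q a n.
Proof.
have q1 : q < 1 by [].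
rewrite /dnorm mulr_gt0// divr_gt0 ?qpoch_inf_gt0 ?(ltW q_gt0)//.
- by rewrite mulr_ge0 ?exprn_ge0// ltW.
- exact: aqn_lt1.
- by rewrite mulr_gt0 ?qpoch_gt0// invr_gt0 exprn_gt0.
- by rewrite qpoch_gt0// aq2_lt1.
Qed.

(** The Christoffel-Darboux formula. *)
Lemma christoffel_darboux x y N :
  (qlattice q a x%:R - qlattice q a y%:R) *
    \sum_(0 <= n < N.+1) D n x * D n y / dnorm q a n =
  recA q a N / dnorm q a N * (D N.+1 x * D N y - D N x * D N.+1 y).
Proof.
have rec n z : qlattice q a z%:R * D n z =
    recA q a n * D n.+1 z + recB q n * D n z + recC q n * D n.-1 z.
  have := congr1 (horner^~ (qlattice q a z%:R))
    (dual_qultra_rec q_gt0 q_lt1 a_gt0 a_lt n).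
  by rewrite /= hornerM hornerX !hornerD !hornerZ.
have h n : dnorm q a n != 0 by rewrite gt_eqF// dnorm_gt0.
elim: N => [|N IH].
  rewrite big_nat1.
  transitivity ((qlattice q a x%:R * D 0 x * D 0 y - D 0 x
    * (qlattice q a y%:R * D 0 y)) / dnorm q a 0).
    by ring.
  by rewrite !rec /= /recC muln0 expr0 subrr oppr0; ring.
rewrite big_nat_recr//= mulrDr IH.
have e : recA q a N / dnorm q a N = recC q N.+1 / dnorm q a N.+1.
  by apply/eqP; rewrite eqr_div// dnormS.
have -> : (qlattice q a x%:R - qlattice q a y%:R)
  * (D N.+1 x * D N.+1 y / dnorm q a N.+1) =
  (qlattice q a x%:R * D N.+1 x * D N.+1 y - D N.+1 x
    * (qlattice q a y%:R * D N.+1 y)) / dnorm q a N.+1.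
  by ring.
by rewrite e !rec /=; ring.
Qed.

(** For lattice indices of the same parity the Casoratian in the
    Christoffel-Darboux formula is divisible by u^2: for odd indices each
    factor is divisible by u, and for even indices the Casoratian is a
    polynomial in u^2 that vanishes at 0. *)
Lemma dual_val_casoratian x y : odd x = odd y -> exists t : {poly R},
  forall u,
    dual_val (q * u) x * dual_val u y - dual_val u x * dual_val (q * u) y =
    u ^+ 2 * t.[u ^+ 2].
Proof.
move=> xy; have [r rE] := dual_val_parity x; have [s sE] := dual_val_parity y.
rewrite -xy in sE; have sq u : (q * u) ^+ 2 = p * u ^+ 2 by rewrite exprMn.
pose W := (r \Po (p *: 'X)) * s - r * (s \Po (p *: 'X)).
have WE v : W.[v] = r.[p * v] * s.[v] - r.[v] * s.[p * v].
  by rewrite /W !hornerE !horner_comp !hornerE.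
have [oddx|evenx] := boolP (odd x).
  exists (q *: W) => u; rewrite !rE !sE oddx sq hornerZ WE; ring.
have : root W 0 by rewrite /root WE mulr0 subrr.
move=> /factor_theorem[t tE]; exists t => u.
rewrite !rE !sE (negPf evenx) sq expr0 !mul1r -WE tE subr0 hornerM hornerX.
by rewrite mulrC.
Qed.

Lemma dual_qultra_column_orthogonal x y : odd x = odd y -> x != y ->
  series (fun n => D n x * D n y / dnorm q a n) @ \oo --> (0 : R).
Proof.
move=> oxy xy.
have l0 : qlattice q a x%:R - qlattice q a y%:R != 0.
  rewrite subr_eq0; apply: contra xy => /eqP/qlattice_inj -> //.
have [t tE] := dual_val_casoratian oxy.
rewrite -(cvg_shiftS (series _)).
pose F N := (qlattice q a x%:R - qlattice q a y%:R)^-1 *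
  (- (1 - p * a * p ^+ N) * q^-1 * (qpoch (a * q ^+ 2) p N / qpoch p p N)
   / S_oo * q ^+ N * t.[p ^+ N]).
(* The prefactor of the Christoffel-Darboux formula grows like q^(-N), which
   leaves a factor q^N. *)
have -> : (fun N => series (fun n => D n x * D n y / dnorm q a n) N.+1) = F.
  apply/funext => N; rewrite /F; apply: (mulfI l0).
  rewrite mulVKf// christoffel_darboux /D !dual_valE// exprS tE.
  have pN : p ^+ N = (q ^+ N) ^+ 2 by rewrite -!exprM mulnC.
  have S0 : S_oo != 0.
    by have := dnorm_gt0 0; rewrite /dnorm => /gt_eqF;
      rewrite mulf_eq0 => /norP[].
  rewrite /recA /dnorm -/p -/S_oo pN.
  have -> : q ^+ (2 * N + 2) = p * (q ^+ N) ^+ 2.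
    by rewrite -exprM -exprD addnC mulnC.
  have -> : q ^+ (2 * N + 1) = q * (q ^+ N) ^+ 2.
    by rewrite -exprM -exprS addn1 mulnC.
  by field; rewrite S0 q0 qX_neq0 !qpoch_neq0// aq2_lt1.
have pN0 : (fun N => p ^+ N) @ \oo --> (0 : R).
  by apply: cvg_expr; rewrite ger0_norm// ltW.
suff : F @ \oo --> (qlattice q a x%:R - qlattice q a y%:R)^-1 *
  (- (1 - p * a * 0) * q^-1 * (qpoch_inf (a * q ^+ 2) p / qpoch_inf p p)
   / S_oo * 0 * t.[0]) by rewrite mulr0 mul0r mulr0.
apply: cvgMr; apply: cvgM; last first.
  by apply: (cvg_comp _ _ pN0); exact: continuous_horner.
apply: cvgM; last by apply: cvg_expr; rewrite ger0_norm// ltW.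
apply: cvgMl; apply: cvgM.
  by apply: cvgMl; apply: cvgN; apply: cvgB; [exact: cvg_cst|exact: cvgMr].
have aq2_ge0 : 0 <= a * q ^+ 2 by rewrite mulr_ge0 ?(ltW p_gt0)// ltW.
apply: cvgM; first by apply: cvg_qpoch => //; exact: aq2_lt1.
apply: cvgV; first by rewrite gt_eqF// qpoch_inf_gt0// ltW.
by apply: cvg_qpoch => //; rewrite ltW.
Qed.

End DualRecurrence.

(** * Orthogonal rows and orthogonal columns give completeness *)

Section SeriesFacts.
Context {R : realType}.
Implicit Types (f g : nat -> R).

Lemma cvg_seriesD f g (l m : R) :
  series f @ \oo --> l -> series g @ \oo --> m ->
  series (fun k => f k + g k) @ \oo --> l + m.
Proof.
by move=> fl gm; rewrite -[X in series X]/((fun k => _) + (fun k => _)) seriesD;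
  exact: cvgD.
Qed.

Lemma cvg_series_sum (f : nat -> nat -> R) (l : nat -> R) m n :
  (forall i, series (f i) @ \oo --> l i) ->
  series (fun k => \sum_(m <= i < n) f i k) @ \oo --> \sum_(m <= i < n) l i.
Proof.
move=> fl; elim: n => [|n IH].
  rewrite big_geq//; under eq_fun do rewrite big_geq//.
  by rewrite /series/=; under eq_fun do rewrite big1//; exact: cvg_cst.
have [mn|nm] := leqP m n; last first.
  rewrite big_geq//; under eq_fun do rewrite big_geq//.
  by rewrite /series/=; under eq_fun do rewrite big1//; exact: cvg_cst.
rewrite big_nat_recr//=; under eq_fun do rewrite big_nat_recr//=.
exact: cvg_seriesD.
Qed.

Lemma cvg_sum_nat (f : nat -> nat -> R) (l : nat -> R) n :
  (forall i, f i @ \oo --> l i) ->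
  (fun k => \sum_(0 <= i < n) f i k) @ \oo --> \sum_(0 <= i < n) l i.
Proof.
move=> fl; elim: n => [|n IH].
  by rewrite big_nil; under eq_fun do rewrite big_nil; exact: cvg_cst.
rewrite big_nat_recr//=; under eq_fun do rewrite big_nat_recr//=.
by apply: cvgD.
Qed.

Lemma cvg_series_fin f n :
  series (fun k => if (k < n)%N then f k else 0) @ \oo -->
  \sum_(0 <= k < n) f k.
Proof.
apply: cvg_near_cst; near=> m.
have nm : (n <= m)%N by near: m; exact: nbhs_infty_ge.
rewrite /series/= (big_cat_nat _ nm)//=
  [X in _ + X]big_nat_cond [X in _ + X]big1 ?addr0.
  by apply: eq_big_nat => k /andP[_ ->].
by move=> k /andP[/andP[nk _] _]; rewrite ltnNge nk.
Unshelve. all: by end_near. Qed.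

Lemma series_le_lim f (l : R) n : (forall k, 0 <= f k) ->
  series f @ \oo --> l -> series f n <= l.
Proof.
move=> f0 fl; rewrite -(cvg_lim _ fl)//; apply: nondecreasing_cvgn_le.
  by apply/nondecreasing_seqP => k; rewrite /series/= big_nat_recr//= lerDl.
by apply/cvg_ex; exists l.
Qed.

Lemma term_le_lim f (l : R) k : (forall k, 0 <= f k) ->
  series f @ \oo --> l -> f k <= l.
Proof.
move=> f0 fl; apply: le_trans (series_le_lim k.+1 f0 fl).
by rewrite /series/= big_nat_recr//= lerDr sumr_ge0.
Qed.

End SeriesFacts.

(** An infinite matrix e, with entry e n k in row n and column k, whose rows
    are orthogonal in l^2(w) with squared norms h, whose columns are pairwise
    orthogonal in l^2(1/h), and whose first row has no zero. *)
Section DualOrthogonality.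
Context {R : realType}.
Context (w h : nat -> R) (e : nat -> nat -> R).
Context (w_gt0 : forall k, 0 < w k) (h_gt0 : forall n, 0 < h n).
Context (rows : forall m n,
  series (fun k => w k * e m k * e n k) @ \oo --> h n * (m == n)%:R).
Context (columns : forall k l, k != l ->
  series (fun n => e n k * e n l / h n) @ \oo --> (0 : R)).
Context (e0_neq0 : forall k, e 0 k != 0).

(** Pythagoras for combinations of rows. *)
Lemma cvg_sqr_comb (c : nat -> R) M N :
  series (fun k => w k * (\sum_(M <= n < N) c n * e n k) ^+ 2) @ \oo -->
  \sum_(M <= n < N) c n ^+ 2 * h n.
Proof.
have -> : (fun k => w k * (\sum_(M <= n < N) c n * e n k) ^+ 2) =
  (fun k => \sum_(M <= m < N) \sum_(M <= n < N)
     (c m * c n) * (w k * e m k * e n k)).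
  apply/funext => k; rewrite expr2 mulr_suml mulr_sumr; apply: eq_bigr => m _.
  by rewrite !mulr_sumr; apply: eq_bigr => n _; ring.
have -> : \sum_(M <= n < N) c n ^+ 2 * h n =
  \sum_(M <= m < N) \sum_(M <= n < N) (c m * c n) * (h n * (m == n)%:R).
  apply: eq_big_nat => m mMN.
  rewrite (bigD1_seq m)/= ?mem_index_iota ?iota_uniq// big1 ?addr0.
    by rewrite eqxx mulr1 expr2.
  by move=> n nm; rewrite eq_sym (negPf nm) !mulr0.
by apply: cvg_series_sum => m; apply: cvg_series_sum => n; exact: cvg_seriesMr.
Qed.

(** The partial sums of the Christoffel-Darboux kernel; as a function of l,
    w_k times this is the orthogonal projection of the indicator of k onto the
    span of the first N rows. *)
Definition ckernel N k l := \sum_(0 <= n < N) e n k / h n * e n l.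

Lemma ckernelD M N k l : (M <= N)%N ->
  ckernel N k l - ckernel M k l = \sum_(M <= n < N) e n k / h n * e n l.
Proof.
by move=> MN; rewrite /ckernel (big_cat_nat _ MN)//= addrAC subrr add0r.
Qed.

(** The kernel partial sums at k form a Cauchy sequence in l^2(w) whenever
    the column of index k is in l^2(1/h). *)
Lemma cvg_ckernelB M N k : (M <= N)%N ->
  series (fun l => w l * (ckernel N k l - ckernel M k l) ^+ 2) @ \oo -->
  ckernel N k k - ckernel M k k.
Proof.
move=> MN; under eq_fun do rewrite ckernelD//; rewrite ckernelD//.
have -> : \sum_(M <= n < N) e n k / h n * e n k =
    \sum_(M <= n < N) (e n k / h n) ^+ 2 * h n.
  by apply: eq_bigr => n _; field; rewrite gt_eqF.
exact: cvg_sqr_comb.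
Qed.

Lemma cvg_ckernel_sqr N k :
  series (fun l => w l * ckernel N k l ^+ 2) @ \oo --> ckernel N k k.
Proof.
have := @cvg_ckernelB 0 N k (leq0n N).
have k0 l : ckernel 0 k l = 0 by rewrite /ckernel big_nil.
by under eq_fun do rewrite k0 subr0; rewrite k0 subr0.
Qed.

Lemma ckernel_diag_homo k :
  {homo (fun N => ckernel N k k) : m n / (m <= n)%N >-> m <= n}.
Proof.
move=> m n mn; rewrite -subr_ge0 ckernelD// sumr_ge0// => i _.
by rewrite mulrAC divr_ge0 ?(ltW (h_gt0 _))// -expr2 sqr_ge0.
Qed.

Lemma ckernel_diag_gt0 N k : 0 < ckernel N.+1 k k.
Proof.
apply: lt_le_trans (ckernel_diag_homo k (ltn0Sn N)).
by rewrite /ckernel big_nat1 mulrAC divr_gt0// -expr2 exprn_even_gt0/=.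
Qed.

(** The term of index k in the sum of [cvg_ckernel_sqr] is at most the sum. *)
Lemma ckernel_diag_le N k : ckernel N.+1 k k <= (w k)^-1.
Proof.
have sq0 l : 0 <= w l * ckernel N.+1 k l ^+ 2.
  by rewrite mulr_ge0 ?sqr_ge0// ltW.
have := term_le_lim k sq0 (@cvg_ckernel_sqr N.+1 k).
by rewrite expr2 mulrA ger_pMl ?ckernel_diag_gt0// -ler_pdivlMl// mulr1.
Qed.

Lemma cvg_ckernel_neq k l : k != l ->
  (fun N => ckernel N k l) @ \oo --> (0 : R).
Proof.
move=> kl; rewrite (_ : (fun N => _) = series (fun n => e n k * e n l / h n)).
  exact: columns.
by apply/funext => N; apply: eq_bigr => n _; rewrite mulrAC.
Qed.

(** The squared norm d of a column is the inverse of the weight: the partial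
    sums of the kernel at k converge in l^2(w) to d times the indicator of k,
    and comparing norms gives d (1 - d w_k) <= 0. *)
Lemma cvg_ckernel_diag k : (fun N => ckernel N k k) @ \oo --> (w k)^-1.
Proof.
have ub N : ckernel N k k <= (w k)^-1.
  by apply: le_trans (ckernel_diag_le N k); exact: ckernel_diag_homo.
have cv : cvgn (fun N => ckernel N k k).
  apply: nondecreasing_is_cvgn; first exact: ckernel_diag_homo.
  by exists (w k)^-1 => _ [N _ <-].
set d := limn (fun N => ckernel N k k).
have dE : (fun N => ckernel N k k) @ \oo --> d by exact: cv.
suff -> : (w k)^-1 = d by [].
have d_gt0 : 0 < d.
  apply: lt_le_trans (ckernel_diag_gt0 0 k) _.
  exact: (nondecreasing_cvgn_le (ckernel_diag_homo k) cv 1).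
have d_le : d <= (w k)^-1 by apply: limr_le => //; near=> N.
apply/eqP; rewrite eq_le d_le andbT.
pose dlt l := d * (k == l)%:R.
have cvl l : (fun N => ckernel N k l) @ \oo --> dlt l.
  rewrite /dlt; have [<-|kl] := eqVneq k l; first by rewrite mulr1.
  by rewrite mulr0; exact: cvg_ckernel_neq.
(* Let the larger kernel index tend to infinity in the partial sums of
   [cvg_ckernelB], as in the lemma of Fatou. *)
have fatou N L : \sum_(0 <= l < L) w l * (dlt l - ckernel N k l) ^+ 2 <=
  d - ckernel N k k.
  have lhs : (fun M => \sum_(0 <= l < L) w l
    * (ckernel M k l - ckernel N k l) ^+ 2) @ \oo -->
     \sum_(0 <= l < L) w l * (dlt l - ckernel N k l) ^+ 2.
    apply: cvg_sum_nat => l; apply: cvgMr.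
    by under eq_fun do rewrite expr2; apply: cvgM;
      (apply: cvgB; [exact: cvl|exact: cvg_cst]).
  have rhs : (fun M => ckernel M k k - ckernel N k k)
    @ \oo --> d - ckernel N k k.
    by apply: cvgB => //; exact: cvg_cst.
  apply: (ler_cvg_to lhs rhs); near=> M.
  have NM : (N <= M)%N by near: M; exact: nbhs_infty_ge.
  have nn l : 0 <= w l * (ckernel M k l - ckernel N k l) ^+ 2.
    by rewrite mulr_ge0 ?sqr_ge0// ltW.
  exact: (series_le_lim L nn (@cvg_ckernelB N M k NM)).
(* Let L tend to infinity: beyond l = k the summand is w_l K_N(k,l)^2. *)
have step N : ckernel N k k - 2 * d * w k * ckernel N k k + d ^+ 2 * w k <=
  d - ckernel N k k.
  have lhs : series (fun l => w l * (dlt l - ckernel N k l) ^+ 2) @ \oo -->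
    ckernel N k k + \sum_(0 <= l < k.+1) (if l ==
      k then d ^+ 2 * w k - 2 * d * w k * ckernel N k k else 0).
    have -> : (fun l => w l * (dlt l - ckernel N k l) ^+ 2) =
      (fun l => w l * ckernel N k l ^+ 2 +
      (if (l < k.+1)%N then (if l ==
        k then d ^+ 2 * w k - 2 * d * w k * ckernel N k k else 0) else 0)).
      apply/funext => l; rewrite /dlt eq_sym; have [->|lk] := eqVneq l k.
        by rewrite ltnSn /= mulr1n; ring.
      by rewrite if_same mulr0n; ring.
    by apply: cvg_seriesD; [exact: cvg_ckernel_sqr|exact: cvg_series_fin].
  move: lhs; rewrite big_nat_recr//= eqxx big_nat big1 => [|l /andP[_ lk]];
    last by rewrite ltn_eqF.
  rewrite add0r => lhs.
  rewrite [leLHS](_ : _ = ckernel N k k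
    + (d ^+ 2 * w k - 2 * d * w k * ckernel N k k)); last by ring.
  rewrite -(cvg_lim _ lhs)//; apply: limr_le; first by apply/cvg_ex; eexists;
    exact: lhs.
  by near=> L; exact: fatou.
have lhs : (fun N => ckernel N k k - 2 * d * w k * ckernel N k k + d ^+ 2 * w k)
    @ \oo --> d - 2 * d * w k * d + d ^+ 2 * w k.
  by apply: cvgD; [apply: cvgB => //; exact: cvgMr|exact: cvg_cst].
have rhs : (fun N => d - ckernel N k k) @ \oo --> d - d.
  by apply: cvgB => //; exact: cvg_cst.
have : d - 2 * d * w k * d + d ^+ 2 * w k <= d - d.
  by apply: (ler_cvg_to lhs rhs); near=> N; exact: step.
have -> : d - 2 * d * w k * d + d ^+ 2 * w k = d * (1 - d * w k) by ring.
rewrite subrr pmulr_rle0// subr_le0 => dw.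
by rewrite -ler_pdivrMr// ?div1r// in dw *.
Unshelve. all: by end_near. Qed.

Lemma cvg_ckernel k l : (fun N => ckernel N k l) @ \oo --> (w k)^-1 * (k ==
  l)%:R.
Proof.
have [<-|kl] := eqVneq k l; first by rewrite mulr1; exact: cvg_ckernel_diag.
by rewrite mulr0; exact: cvg_ckernel_neq.
Qed.

(** The rows span a dense subspace of l^2(w). *)
Lemma rows_dense (f : nat -> R) (s eps : R) : 0 < eps ->
  series (fun k => w k * f k ^+ 2) @ \oo --> s ->
  exists N (c : nat -> R), forall K,
    \sum_(0 <= k < K) w k * (f k - \sum_(0 <= n < N) c n * e n k) ^+ 2 <= eps.
Proof.
move=> eps0 fs.
have f0 k : 0 <= w k * f k ^+ 2 by rewrite mulr_ge0 ?sqr_ge0// ltW.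
(* Truncate f to its first L values, with a tail of norm at most eps / 4, and
   project the truncation g onto the span of the first N rows. *)
have [L Ls] : exists L, s - \sum_(0 <= k < L) w k * f k ^+ 2 <= eps / 4.
  have /cvgrPdist_le/(_ (eps / 4)) := fs;
    rewrite divr_gt0// => /(_ isT)[L _ /(_ L (leqnn L))] /= h1.
  by exists L; apply: le_trans h1; exact: ler_norm.
pose g k := if (k < L)%N then f k else 0.
pose c n := \sum_(0 <= k < L) w k * f k * (e n k / h n).
pose F N k := \sum_(0 <= n < N) c n * e n k.
have errE N : series (fun k => w k * (g k - F N k) ^+ 2) @ \oo -->
    \sum_(0 <= k < L) w k * f k ^+ 2 - \sum_(0 <= n < N) c n ^+ 2 * h n.
  have -> : \sum_(0 <= k < L) w k * f k ^+ 2 - \sum_(0 <= n < N) c n ^+ 2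
    * h n =
    \sum_(0 <= n < N) c n ^+ 2 * h n +
    \sum_(0 <= k < L) (w k * f k ^+ 2 - 2 * (w k * f k * F N k)).
    rewrite sumrB -mulr_sumr.
    have -> : \sum_(0 <= k < L) w k * f k * F N k =
      \sum_(0 <= n < N) c n ^+ 2 * h n.
      under eq_bigr do rewrite mulr_sumr.
      rewrite exchange_big/=; apply: eq_bigr => n _.
      rewrite expr2 -mulrA [X in _ = _ * X]mulr_suml mulr_sumr;
        apply: eq_bigr => k _.
      by field; rewrite gt_eqF.
    by ring.
  have -> : (fun k => w k * (g k - F N k) ^+ 2) = (fun k => w k * F N k ^+ 2 +
     (if (k < L)%N then w k * f k ^+ 2 - 2 * (w k * f k * F N k) else 0)).
    by apply/funext => k; rewrite /g; case: ifPn => _; ring.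
  by apply: cvg_seriesD; [exact: cvg_sqr_comb|exact: cvg_series_fin].
(* The Parseval identity for g, by the limit of the kernel. *)
have err0 : (fun N => \sum_(0 <= n < N) c n ^+ 2 * h n) @ \oo -->
  \sum_(0 <= k < L) w k * f k ^+ 2.
  have -> : (fun N => \sum_(0 <= n < N) c n ^+ 2 * h n) = (fun N =>
    \sum_(0 <= k < L) \sum_(0 <= l < L) (w k * f k * (w l * f l))
      * ckernel N k l).
    apply/funext => N.
    under [RHS]eq_bigr do under eq_bigr do rewrite mulr_sumr.
    under [RHS]eq_bigr do rewrite exchange_big/=.
    rewrite [RHS]exchange_big/=; apply: eq_bigr => n _.
    rewrite expr2 /c mulr_suml mulr_suml; apply: eq_bigr => k _.
    rewrite mulr_sumr mulr_suml; apply: eq_bigr => l _.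
    by field; rewrite gt_eqF.
  have -> : \sum_(0 <= k < L) w k * f k ^+ 2 =
    \sum_(0 <= k < L) \sum_(0 <= l < L) (w k * f k * (w l * f l))
      * ((w k)^-1 * (k == l)%:R).
    apply: eq_big_nat => k kL.
    rewrite (bigD1_seq k)/= ?mem_index_iota ?iota_uniq// big1 ?addr0.
      by rewrite eqxx mulr1n; field; rewrite gt_eqF.
    by move=> l lk; rewrite eq_sym (negPf lk) !mulr0.
  apply: cvg_sum_nat => k; apply: cvg_sum_nat => l; apply: cvgMr;
    exact: cvg_ckernel.
have [N HN] : exists N,
  \sum_(0 <= k < L) w k * f k ^+ 2 - \sum_(0 <= n < N) c n ^+ 2 * h n <= eps / 4.
  have /cvgrPdist_le/(_ (eps / 4)) := err0;
    rewrite divr_gt0// => /(_ isT)[N _ /(_ N (leqnn N))] /= h1.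
  by exists N; apply: le_trans h1; exact: ler_norm.
exists N, c => K.
have gF0 k : 0 <= w k * (g k - F N k) ^+ 2 by rewrite mulr_ge0 ?sqr_ge0// ltW.
have fg0 k : 0 <= w k * (f k - g k) ^+ 2 by rewrite mulr_ge0 ?sqr_ge0// ltW.
have h1 := le_trans (series_le_lim K gF0 (errE N)) HN.
have h2 : \sum_(0 <= k < K) w k * (f k - g k) ^+ 2 <= eps / 4.
  apply: le_trans Ls; apply:
    (@series_le_lim _ (fun k => w k * (f k - g k) ^+ 2)) => //.
  have -> : (fun k => w k * (f k - g k) ^+ 2) = (fun k => w k * f k ^+ 2 +
     (if (k < L)%N then - (w k * f k ^+ 2) else 0)).
    by apply/funext => k; rewrite /g; case: ifPn => _; ring.
  by apply: cvg_seriesD => //; rewrite -sumrN; exact: cvg_series_fin.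
apply: (@le_trans _ _ (2 * \sum_(0 <= k < K) w k * (f k - g k) ^+ 2 +
                       2 * \sum_(0 <= k < K) w k * (g k - F N k) ^+ 2)).
  rewrite !mulr_sumr -big_split/=; apply: ler_sum => k _; rewrite -/(F N k).
  rewrite -subr_ge0.
  have -> : 2 * (w k * (f k - g k) ^+ 2) + 2 * (w k * (g k - F N k) ^+ 2) -
    w k * (f k - F N k) ^+ 2 = w k * (f k - g k - (g k - F N k)) ^+ 2 by ring.
  by rewrite mulr_ge0 ?sqr_ge0// ltW.
move: h1; rewrite /series/= => h1; lra.
Qed.

End DualOrthogonality.

(** * From sequences to the discrete measure *)

Section PointMasses.
Context {R : realType}.
Context (w pt : nat -> R) (w_gt0 : forall k, 0 < w k).

Let m := point_masses w pt.
Implicit Types f g : measurableTypeR R -> R.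

Lemma ge0_integral_point_masses g :
  measurable_fun setT g -> (forall x, 0 <= g x) ->
  (\int[m]_x (g x)%:E = \sum_(k <oo) (w k * g (pt k))%:E)%E.
Proof.
move=> mg g0; rewrite /m /point_masses ge0_integral_measure_series//;
  last 2 first.
- by move=> x _; rewrite lee_fin.
- exact/measurable_EFinP.
apply: eq_eseriesr => k _; rewrite ge0_integral_mscale//=; last 2 first.
- exact/measurable_EFinP.
- by move=> x _; rewrite lee_fin.
rewrite integral_dirac//; last exact/measurable_EFinP.
by rewrite diracT mul1e -EFinM gtr0_norm.
Qed.

Lemma integral_point_masses_lim g (l : R) :
  measurable_fun setT g -> (forall x, 0 <= g x) ->
  series (fun k => w k * g (pt k)) @ \oo --> l ->
  (\int[m]_x (g x)%:E = l%:E)%E.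
Proof.
move=> mg g0 gl; rewrite ge0_integral_point_masses//.
rewrite -(cvg_lim _ gl)// -EFin_lim; last by apply/cvg_ex; exists l.
by congr (limn _); apply/funext => n; rewrite /= /series/= sumEFin.
Qed.

Lemma integral_point_masses_le g (B : R) :
  measurable_fun setT g -> (forall x, 0 <= g x) ->
  (forall K, \sum_(0 <= k < K) w k * g (pt k) <= B) ->
  (\int[m]_x (g x)%:E <= B%:E)%E.
Proof.
move=> mg g0 gB; rewrite ge0_integral_point_masses//.
apply: lime_le; last by near=> n; rewrite sumEFin lee_fin.
by apply: is_cvg_nneseries => k _ _; rewrite lee_fin mulr_ge0// ltW.
Unshelve. all: by end_near. Qed.

Lemma cvg_series_point_masses g :
  measurable_fun setT g -> (forall x, 0 <= g x) ->
  (\int[m]_x (g x)%:E < +oo)%E ->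
  exists l : R, series (fun k => w k * g (pt k)) @ \oo --> l.
Proof.
move=> mg g0; rewrite ge0_integral_point_masses// => fin.
have wg k : 0 <= w k * g (pt k) by rewrite mulr_ge0// ltW.
apply/cvg_ex; apply: nondecreasing_is_cvgn.
  by apply/nondecreasing_seqP => k; rewrite /series/= big_nat_recr//= lerDl.
exists (fine (\sum_(k <oo) (w k * g (pt k))%:E)%E) => _ [n _ <-].
rewrite -lee_fin fineK; last first.
  by rewrite ge0_fin_numE// nneseries_ge0// => k _ _; rewrite lee_fin.
rewrite /series/= -sumEFin; apply: nneseries_lim_ge => k _ _.
by rewrite lee_fin.
Qed.

Lemma Lnorm2_point_masses f :
  measurable_fun setT f ->
  ('N[m]_2%:E[EFin \o f] = (\int[m]_x (f x ^+ 2)%:E) `^ 2^-1)%E.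
Proof.
move=> mf; rewrite unlock; congr (_ `^ _)%E; apply: eq_integral => x _.
by rewrite /= powR_mulrn// real_normK// num_real.
Qed.

Lemma Lfun2_point_masses f : measurable_fun setT f ->
  (f \in Lfun m 2%:E) <-> (\int[m]_x (f x ^+ 2)%:E < +oo)%E.
Proof.
move=> mf; split => [|fin].
  rewrite inE => /andP[_]; rewrite inE/= /finite_norm Lnorm2_point_masses//.
  by apply: lty_poweRy; rewrite invr_neq0.
rewrite inE; apply/andP; split;
  rewrite inE//= /finite_norm Lnorm2_point_masses//.
exact: poweR_lty.
Qed.

(** A family of polynomials whose values at the points satisfy the two dual
    orthogonality relations is extremal. *)
Lemma extremal_point_masses (h : nat -> R) (P : nat -> {poly R}) :
  (forall n, 0 < h n) ->
  (forall n n', series (fun k => w k * (P n).[pt k] * (P n').[pt k]) @ \oo -->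
     h n' * (n == n')%:R) ->
  (forall k l, k != l ->
     series (fun n => (P n).[pt k] * (P n).[pt l] / h n) @ \oo --> (0 : R)) ->
  P 0%N = 1 ->
  extremal m P.
Proof.
move=> h0 rows cols P0.
have mP (p : {poly R}) : measurable_fun setT
  (horner p : measurableTypeR R -> R).
  exact: measurable_poly.
have mP2 (p : {poly R}) : measurable_fun setT
  (fun x : measurableTypeR R => p.[x] ^+ 2).
  exact: measurable_funX.
have intP2 n : (\int[m]_x ((P n).[x] ^+ 2)%:E = (h n)%:E)%E.
  apply: integral_point_masses_lim => //; first by move=> x; exact: sqr_ge0.
  have := rows n n; rewrite eqxx mulr1.
  by under eq_fun do rewrite -mulrA -expr2.
split; first split.
- by move=> n; apply/Lfun2_point_masses => //; rewrite intP2 ltry.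
- move=> n n' nn'.
  (* Polarization, with s = 1 and s = -1: only integrals of squares are series
     of nonnegative terms. *)
  have quarter (s : R) : s ^+ 2 = 1 ->
      (\int[m]_x (((2^-1)%:P * (P n + s *: P n')).[x] ^+ 2)%:E =
        ((h n + h n') / 4)%:E)%E.
    move=> s1; apply: integral_point_masses_lim => //; first by move=> x;
      exact: sqr_ge0.
    have -> : (h n + h n') / 4 =
      4^-1 * (h n + (h n' + s * 2 * (h n' * (n == n')%:R))).
      by rewrite (negPf nn') mulr0n; ring.
    have -> : (fun k => w k * ((2^-1)%:P * (P n + s *: P n')).[pt k] ^+ 2) =
      (fun k => 4^-1 *
      (w k * (P n).[pt k] * (P n).[pt k] + (w k * (P n').[pt k] * (P n').[pt k]
        + s * 2 * (w k * (P n).[pt k] * (P n').[pt k])))).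
      apply/funext => k; rewrite !(hornerM, hornerD, hornerZ, hornerC).
      transitivity (4^-1 * (w k * (P n).[pt k] * (P n).[pt k]
        + (s ^+ 2 * (w k * (P n').[pt k] * (P n').[pt k])
        + s * 2 * (w k * (P n).[pt k] * (P n').[pt k])))); first by field.
      by rewrite s1 mul1r.
    apply: cvg_seriesMr; apply: cvg_seriesD.
      by have := rows n n; rewrite eqxx mulr1.
    apply: cvg_seriesD; first by have := rows n' n'; rewrite eqxx mulr1.
    exact: cvg_seriesMr.
  have integ (s : R) : s ^+ 2 = 1 -> m.-integrable setT
      (EFin \o (fun x => ((2^-1)%:P * (P n + s *: P n')).[x] ^+ 2)).
    move=> s1; apply/integrableP; split; first exact/measurable_EFinP.
    under eq_integral do rewrite /= ger0_norm ?sqr_ge0//.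
    by rewrite quarter// ltry.
  have s1 : (1 : R) ^+ 2 = 1 by rewrite expr1n.
  have sN1 : (-1 : R) ^+ 2 = 1 by rewrite sqrrN expr1n.
  transitivity (\int[m]_x ((((2^-1)%:P * (P n + 1 *: P n')).[x] ^+ 2)%:E -
     (((2^-1)%:P * (P n + -1 *: P n')).[x] ^+ 2)%:E))%E.
    apply: eq_integral => x _; rewrite -EFinB; congr EFin.
    by rewrite !(hornerM, hornerD, hornerZ, hornerC); field.
  rewrite integralB_EFin//; [|exact: integ|exact: integ].
  by rewrite !quarter// subee.
- by move=> n; rewrite intP2 lte_fin.
move=> f fL2 eps eps0.
have mf : measurable_fun setT f by move: fL2; rewrite inE => /andP[+ _];
  rewrite inE.
have mf2 : measurable_fun setT (fun x => f x ^+ 2) by exact: measurable_funX.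
have [s sE] : exists l : R, series (fun k => w k * f (pt k) ^+ 2) @ \oo --> l.
  apply: (@cvg_series_point_masses (fun x => f x ^+ 2)) => //;
    first by move=> x; exact: sqr_ge0.
  exact/Lfun2_point_masses.
have e2 : 0 < (eps / 2) ^+ 2 by rewrite exprn_gt0// divr_gt0.
have e0 k : (P 0%N).[pt k] != 0 by rewrite P0 hornerC oner_neq0.
have [N [c cE]] := rows_dense w_gt0 h0 rows cols e0 e2 sE.
exists N, c; pose r := \sum_(0 <= i < N) c i *: P i.
have rE x : \sum_(0 <= i < N) c i * (P i).[x] = r.[x].
  by rewrite /r horner_sum; apply: eq_bigr => i _; rewrite hornerZ.
have mfr : measurable_fun setT
  (fun x : measurableTypeR R => f x - \sum_(0 <= i < N) c i * (P i).[x]).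
  by under eq_fun do rewrite rE; apply: measurable_funB.
rewrite Lnorm2_point_masses//.
have le_int : (\int[m]_x ((f x - \sum_(0 <= i < N) c i * (P i).[x]) ^+ 2)%:E <=
  ((eps / 2) ^+ 2)%:E)%E.
  apply: integral_point_masses_le => //; last by move=> x; exact: sqr_ge0.
  exact: measurable_funX.
have int_ge0 : (0 <= \int[m]_x
  ((f x - \sum_(0 <= i < N) c i * (P i).[x]) ^+ 2)%:E)%E.
  by apply: integral_ge0 => x _; rewrite lee_fin sqr_ge0.
apply: (@le_lt_trans _ _ ((((eps / 2) ^+ 2)%:E) `^ 2^-1)%E).
  by apply: gt0_ler_poweR => //;
    rewrite ?invr_ge0// in_itv/= leey ?andbT// lee_fin sqr_ge0.
rewrite poweR_EFin lte_fin.
rewrite -powR_mulrn ?divr_ge0 ?(ltW eps0)// -powRrM mulfV// powRr1 ?divr_ge0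
  ?(ltW eps0)//.
by rewrite ltr_pdivrMr// mulr2n mulrDr mulr1 ltrDl.
Qed.

End PointMasses.

(** * The orthogonality relations and extremality *)

Theorem mainTheorem5 (R : realType) (q a : R)
    (q_gt0 : 0 < q) (q_lt1 : q < 1) (a_gt0 : 0 < a) (a_lt : a < q ^- 2) :
  [/\ forall n n' : nat,
        series (fun k : nat => even_weight q a k *
          (dual_qultra q a n).[qlattice q a (2 * k)%:R] *
          (dual_qultra q a n').[qlattice q a (2 * k)%:R]) @ \oo -->
        qpoch_inf (a * q ^+ 3) (q ^+ 2) / qpoch_inf q (q ^+ 2) *
          (qpoch (q ^+ 2) (q ^+ 2) n * q ^- n /
           qpoch (a * q ^+ 2) (q ^+ 2) n) * (n == n')%:R,
      forall n n' : nat,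
        series (fun k : nat => odd_weight q a k *
          (dual_qultra q a n).[qlattice q a (2 * k + 1)%:R] *
          (dual_qultra q a n').[qlattice q a (2 * k + 1)%:R]) @ \oo -->
        qpoch_inf (a * q ^+ 3) (q ^+ 2) / qpoch_inf q (q ^+ 2) *
          (qpoch (q ^+ 2) (q ^+ 2) n * q ^- n /
           qpoch (a * q ^+ 2) (q ^+ 2) n) * (n == n')%:R,
      extremal (point_masses (even_weight q a)
                  (fun k : nat => qlattice q a (2 * k)%:R))
               (dual_qultra q a)
    & extremal (point_masses (odd_weight q a)
                  (fun k : nat => qlattice q a (2 * k + 1)%:R))
               (dual_qultra q a)].
Proof.
pose D := dual_qultra q a.
have rows n n' : has_moment q a (D n * D n') (dnorm q a n * (n == n')%:R).
  by rewrite mulrC eq_sym; exact: has_moment_dual_qultraM.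
have even_rows n n' : series (fun k => even_weight q a k *
    (D n).[qlattice q a (2 * k)%:R] * (D n').[qlattice q a (2 * k)%:R]) @ \oo -->
    dnorm q a n * (n == n')%:R.
  by have [+ _] := rows n n'; under eq_fun do rewrite hornerM mulrA.
have odd_rows n n' : series (fun k => odd_weight q a k *
    (D n).[qlattice q a (2 * k + 1)%:R] *
    (D n').[qlattice q a (2 * k + 1)%:R]) @ \oo --> dnorm q a n * (n == n')%:R.
  by have [_] := rows n n'; under eq_fun do rewrite hornerM mulrA.
have normC n n' : dnorm q a n * (n == n')%:R = dnorm q a n' * (n == n')%:R.
  by have [->//|_] := eqVneq n n'; rewrite !mulr0.
split=> [n n'|n n'||].
- exact: even_rows.
- exact: odd_rows.
- apply: (@extremal_point_masses _ _ _ _ (dnorm q a)).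
  + by move=> k; exact: even_weight_gt0.
  + by move=> n; exact: dnorm_gt0.
  + by move=> n n'; rewrite -normC; exact: even_rows.
  + move=> k l kl; apply: dual_qultra_column_orthogonal => //; lia.
  + exact: dual_qultra0.
- apply: (@extremal_point_masses _ _ _ _ (dnorm q a)).
  + by move=> k; exact: odd_weight_gt0.
  + by move=> n; exact: dnorm_gt0.
  + by move=> n n'; rewrite -normC; exact: odd_rows.
  + move=> k l kl; apply: dual_qultra_column_orthogonal => //; lia.
  + exact: dual_qultra0.
Qed.
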